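(* Let $(G_i)_{i\in I}$ be a family of finite groups, indexed by an arbitrary set $I$, and let $G=\bigoplus_{i\in I}G_i$ be their restricted direct product. Let $\omega$ be an algebra character on $\mathrm{Z}\ell^1(G)$ and let $(\chi_i)_{i\in I}$ be the corresponding family of irreducible (unnormalized) group characters, $\chi_i$ being a character of $G_i$ of degree $d_{\chi_i}$. Then the ideal $\ker\omega$ has a bounded approximate identity if and only if $d_{\chi_i}\|\chi_i\|_1=|G_i|$ for all but finitely many $i\in I$.
   Context: The restricted direct product $\bigoplus_{i\in I}G_i$ is the subgroup of $\prod_{i\in I}G_i$ consisting of all $(x_i)$ with $x_i=e_{G_i}$ for all but finitely many $i$, regarded as a discrete group. For a discrete group $G$, $\ell^1(G)$ is the convolution algebra with respect to counting measure and $\mathrm{Z}\ell^1(G)$ is its centre. An algebra character is a non-zero multiplicative linear functional. A group character of a finite group $H$ is the (unnormalized) trace $\chi$ of a finite-dimensional complex representation; its degree is $d_\chi=\chi(e)$, and $\|\chi\|_1=\sum_{x\in H}|\chi(x)|$. Correspondence: for each $j\in I$ the coordinate inclusion $G_j\hookrightarrow G$ induces (extension by zero) a unital isometric homomorphism $\imath_j:\mathrm{Z}\ell^1(G_j)\to \mathrm{Z}\ell^1(G)$. For an algebra character $\omega$ of $\mathrm{Z}\ell^1(G)$, $\omega\circ\imath_j$ is an algebra character of $\mathrm{Z}\ell^1(G_j)$, and there is a unique irreducible group character $\chi_j$ of $G_j$ with $\omega(\imath_j(f))=\sum_{x\in G_j}f(x)\,d_{\chi_j}^{-1}\chi_j(x^{-1})$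 for all $f\in\mathrm{Z}\ell^1(G_j)$. The family $(\chi_j)_{j\in I}$ is the family corresponding to $\omega$; the map $\omega\mapsto(\chi_j)_{j\in I}$ is a bijection from algebra characters of $\mathrm{Z}\ell^1(G)$ onto families of irreducible group characters of the $G_j$. A bounded approximate identity for a commutative Banach algebra $J$ is a norm-bounded net $(h_\alpha)$ in $J$ with $h_\alpha f\to f$ in norm for all $f\in J$. *)

(* Defs.v *)
From HB Require Import structures.
From mathcomp Require Import all_boot all_order all_algebra all_fingroup.
From mathcomp Require Import mxrepresentation complex.
From mathcomp Require Import all_classical all_reals all_analysis.
From mathcomp.analysis.showcase Require summability.

Set Implicit Arguments.
Unset Strict Implicit.
Unset Printing Implicit Defensive.

Import Order.TTheory GRing.Theory Num.Theory numFieldNormedType.Exports.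

Local Open Scope classical_set_scope.
Local Open Scope ring_scope.

Section RestrictedProduct.
Variables (I : Type) (G : I -> groupType).

Record restr_prod : Type := RestrProd {
  rp_val :> forall i, G i;
  rp_fin : finite_set [set i | rp_val i != 1%g]
}.

HB.instance Definition _ := gen_eqMixin restr_prod.
HB.instance Definition _ := gen_choiceMixin restr_prod.

Lemma rp_ext (x y : restr_prod) : (forall i, x i = y i) -> x = y.
Proof.
case: x y => [x fx] [y fy] /= exy.
have {}exy : x = y by exact: functional_extensionality_dep exy.
by move: fy; rewrite -exy => fy; congr RestrProd; exact: Prop_irrelevance.
Qed.

Lemma rp_one_fin : finite_set [set i | (1%g : G i) != 1%g].
Proof. by rewrite (_ : [set _ | _] = set0) // -subset0 => i /=; rewrite eqxx. Qed.

Lemma rp_mul_fin (x y : restr_prod) :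
  finite_set [set i | (x i * y i)%g != 1%g].
Proof.
have fU := conj (rp_fin x) (rp_fin y); rewrite -finite_setU in fU.
apply: sub_finite_set fU => i /= xy1.
have [x1|] := eqVneq (x i) 1%g; last by left.
by right; rewrite x1 mul1g in xy1.
Qed.

Lemma rp_inv_fin (x : restr_prod) : finite_set [set i | ((x i)^-1)%g != 1%g].
Proof. by apply: sub_finite_set (rp_fin x) => i /=; rewrite invg_eq1. Qed.

Definition rp_one := RestrProd rp_one_fin.
Definition rp_mul x y := RestrProd (rp_mul_fin x y).
Definition rp_inv x := RestrProd (rp_inv_fin x).

Lemma rp_mulA : associative rp_mul.
Proof. by move=> x y z; apply: rp_ext => i; apply: mulgA. Qed.
Lemma rp_mul1 : left_id rp_one rp_mul.
Proof. by move=> x; apply: rp_ext => i; apply: mul1g. Qed.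
Lemma rp_mulr1 : right_id rp_one rp_mul.
Proof. by move=> x; apply: rp_ext => i; apply: mulg1. Qed.
Lemma rp_mulV : left_inverse rp_one rp_inv rp_mul.
Proof. by move=> x; apply: rp_ext => i; apply: mulVg. Qed.
Lemma rp_mulVr : right_inverse rp_one rp_inv rp_mul.
Proof. by move=> x; apply: rp_ext => i; apply: mulgV. Qed.

HB.instance Definition _ :=
  isGroup.Build restr_prod rp_mulA rp_mul1 rp_mulr1 rp_mulV rp_mulVr.

(* [dfwith] needs an [eqType] of indices; [{classic I}] is [I] with classical
   decidable equality. *)
Definition coord_fun (j : I) (g : G j) : forall i, G i :=
  @dfwith {classic I} G (fun=> 1%g) j g.

Lemma coord_fin j (g : G j) : finite_set [set i | coord_fun g i != 1%g].
Proof.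
apply: (@sub_finite_set _ _ [set j]); last exact: finite_set1.
move=> i /=; rewrite /coord_fun; case: (@dfwithP {classic I}) => // k _.
by rewrite eqxx.
Qed.

Definition coord_incl (j : I) (g : G j) : restr_prod := RestrProd (coord_fin g).

End RestrictedProduct.

Section GroupAlgebra.
Variables (R : realType) (G : groupType).
Local Notation C := R[i].
Implicit Types (f g : G -> C) (w : (G -> C) -> C) (J : set (G -> C)).

Definition ell1 : set (G -> C) :=
  [set f | summable setT (fun x => (ComplexField.Normc.normc (f x))%:E)].

(* Only meaningful on [ell1]: [fine] sends an infinite sum to 0. *)
Definition norm1 f : R :=
  fine (\esum_(x in setT) (ComplexField.Normc.normc (f x))%:E).

(* [summability.sum] is the unconditional sum: the limit of the finite partial
   sums along the net of finite subsets of [G]. *)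
Definition convol f g : G -> C :=
  fun x => summability.sum (fun y : G => (f y * g (y^-1 * x)%g : C^o)).

Definition Zell1 : set (G -> C) :=
  [set f | ell1 f /\ forall g, ell1 g -> convol f g = convol g f].

(* A functional on [Zell1] is a function on all of [G -> C] of which only the
   values on [Zell1] are ever used. *)
Definition algebra_character w : Prop :=
  [/\ forall (a : C) f g, Zell1 f -> Zell1 g ->
        w (a \*o f \+ g) = a * w f + w g,
      forall f g, Zell1 f -> Zell1 g -> w (convol f g) = w f * w g
    & exists2 f, Zell1 f & w f != 0].

Definition character_ker w : set (G -> C) := [set f | Zell1 f /\ w f = 0].

Definition directed (A : Type) (le : A -> A -> Prop) : Prop :=
  [/\ inhabited A, (forall a, le a a),
      (forall a b c, le a b -> le b c -> le a c)
    & forall a b, exists2 c, le a c & le b c].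

Definition net_tails (A : Type) (le : A -> A -> Prop) : set_system A :=
  filter_from setT (fun a0 => [set a | le a0 a]).

Definition has_bounded_approx_id J : Prop :=
  exists (A : Type) (le : A -> A -> Prop) (h : A -> G -> C),
    [/\ directed le,
        forall a, J (h a),
        exists M : R, forall a, norm1 (h a) <= M
      & forall f, J f ->
          norm1 (convol (h a) f \- f) @[a --> net_tails le] --> (0 : R)].

End GroupAlgebra.

Definition irr_group_character (R : realType) (gT : finGroupType)
    (chi : gT -> R[i]) : Prop :=
  exists (n : nat) (rG : mx_representation R[i] [set: gT]%G n),
    mx_irreducible rG /\ forall x, chi x = \tr (rG x).

Section Correspondence.
Variables (R : realType) (I : Type) (G : I -> finGroupType).
Local Notation C := R[i].

Definition ext_zero (j : I) (f : G j -> C) : restr_prod G -> C :=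
  fun x => if x \in range (@coord_incl I G j) then f (x j) else 0.

Definition corresponding_family (w : (restr_prod G -> C) -> C)
    (chi : forall j, G j -> C) : Prop :=
  forall j, irr_group_character (chi j) /\
    forall f : G j -> C, Zell1 f ->
      w (ext_zero f) = \sum_(x : G j) f x * (chi j 1%g)^-1 * chi j (x^-1)%g.

End Correspondence.

(* Main.v *)
(* Restricting [w] to the factor [G i] singles out the minimal central
   idempotent [p_i = d_i chi_i / |G_i|] (up to inversion), whose norm is
   [d_i ||chi_i||_1 / |G_i| >= 1].  For a finite set [F] of indices the product
   [p_F] of the [p_i] satisfies [p_F * f = w(f) p_F] for central [f] supported on
   the factors of [F], and its norm is the product of the norms of the [p_i].
   If these norms are bounded, [1 - p_F] is a bounded approximate identity of
   [ker w]; conversely a bounded approximate identity bounds them.  Hence the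
   theorem reduces to a gap: [||p_i||], if not 1, is at least 1 + 1/1000.

   For the gap, let [psi = chi / d].  It is a positive definite function, so
   [|psi|] is nearly multiplicative where it is close to 1.  If the norm of the
   idempotent is close to 1, almost all the mass of [psi] sits where [|psi|] is
   almost 1, and a counting argument shows that this set is stable under
   products; averaging [psi (x * x ^ h)] over [h] then forces [|psi| = 1] there,
   and the convolution equation for [psi] forces [psi = 0] elsewhere. *)

Require Import Defs.
From mathcomp Require Import all_boot all_order all_algebra all_fingroup.
From mathcomp Require Import mxrepresentation finmap complex ring lra.
From mathcomp Require Import all_classical all_reals all_analysis.
From mathcomp.analysis.showcase Require summability.
(* [fingroup] has a lemma [norm1], which would hide the norm of [Defs]. *)
Import Defs.

Set Implicit Arguments.
Unset Strict Implicit.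
Unset Printing Implicit Defensive.

Import Order.TTheory GRing.Theory Num.Theory numFieldNormedType.Exports.

Local Open Scope ring_scope.

Local Notation nrm := ComplexField.Normc.normc.
Local Notation cj := conjc.

(** * The norm gap for minimal central idempotents *)

Section Modulus.
Local Open Scope complex_scope.
Variable R : rcfType.
Implicit Types x y : R[i].

Lemma normc_ge0 x : 0 <= nrm x.
Proof. by case: x => a b /=; rewrite sqrtr_ge0. Qed.

Lemma normc_eq0 x : (nrm x == 0) = (x == 0).
Proof.
apply/eqP/eqP => [|->]; first exact: ComplexField.Normc.eq0_normc.
exact: ComplexField.Normc.normc0.
Qed.

Lemma normc_conj x : nrm (cj x) = nrm x.
Proof. by case: x => a b /=; rewrite sqrrN. Qed.

Lemma mulcJ x : x * cj x = (nrm x ^+ 2)%:C.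
Proof.
case: x => a b /=; simpc; rewrite sqr_sqrtr ?addr_ge0 ?sqr_ge0 //.
by congr (_ +i* _); rewrite mulrC addNr.
Qed.

Lemma normcB_sqr x y :
  nrm (x - y) ^+ 2 = nrm x ^+ 2 + nrm y ^+ 2 - 2 * complex.Re (x * cj y).
Proof.
case: x y => a b [c d] /=; rewrite !sqr_sqrtr ?addr_ge0 ?sqr_ge0 //; ring.
Qed.

Lemma normc_sum (I : Type) (r : seq I) (P : pred I) (f : I -> R[i]) :
  nrm (\sum_(i <- r | P i) f i) <= \sum_(i <- r | P i) nrm (f i).
Proof.
elim/big_ind2: _ => [|u a v b ua vb|//].
  by rewrite ComplexField.Normc.normc0.
exact: le_trans (le_normcD _ _) (lerD ua vb).
Qed.

Lemma normc_real (r : R) : 0 <= r -> nrm r%:C = r.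
Proof. by move=> r0; rewrite /= expr0n addr0 sqrtr_sqr ger0_norm. Qed.

End Modulus.

Ltac gsimp := rewrite ?conjgE ?(invMg, invgK, mulgA)
  ?(mulgK, mulgKV, mulVg, mulgV, mul1g, mulg1) //.

(** * Spherical functions for conjugation on a finite group *)

Section Spherical.
Local Open Scope complex_scope.
Variables (R : rcfType) (H : finGroupType).
Implicit Types (psi f : H -> R[i]) (x y : H).

(** The functional equation of a normalized irreducible character [chi / d]. The whole gap argument
    is drawn from it, without going back to representations. *)
Definition spherical psi : Prop :=
  psi 1%g = 1 /\ forall x y, \sum_(h : H) psi (x * y ^ h)%g = #|H|%:R * psi x * psi y.

Lemma cardC_neq0 : (#|H|%:R : R[i]) != 0.
Proof. by rewrite pnatr_eq0 -lt0n; apply/card_gt0P; exists 1%g. Qed.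

Lemma spherical_class psi : spherical psi -> forall x y, psi (x ^ y)%g = psi x.
Proof.
move=> [psi1 psiM] x y; apply: (mulfI cardC_neq0).
have E z : #|H|%:R * psi z = \sum_(h : H) psi (z ^ h)%g.
  transitivity (\sum_(h : H) psi (1 * z ^ h)%g); first by rewrite psiM psi1 mulr1.
  by apply: eq_bigr => h _; rewrite mul1g.
rewrite !E [RHS](reindex_inj (mulgI y)) /=.
by apply: eq_bigr => h _; rewrite conjgM.
Qed.

(** As [f] is a class function, [y] may be replaced by its conjugate inside [psi] without changing
    the sum; averaging over the conjugator brings in the functional equation. *)
Lemma spherical_convol psi f :
  spherical psi -> (forall x y, f (x ^ y)%g = f x) ->
  forall x, \sum_y psi (x * y^-1)%g * f y = psi x * \sum_y psi y^-1%g * f y.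
Proof.
move=> [psi1 psiM] fJ x; apply: (mulfI cardC_neq0).
transitivity (\sum_(h : H) \sum_y psi (x * y^-1)%g * f y).
  by rewrite sumr_const mulr_natl.
rewrite (eq_bigr (fun h : H => \sum_y psi (x * y^-1 ^ h)%g * f y)); last first.
  move=> h _; rewrite (reindex_inj (conjg_inj h)) /=.
  by apply: eq_bigr => y _; rewrite conjVg fJ.
rewrite exchange_big /= !mulr_sumr; apply: eq_bigr => y _.
by rewrite -mulr_suml psiM !mulrA.
Qed.

Lemma spherical_adj psi :
  spherical psi -> spherical (fun x => cj (psi x^-1%g)).
Proof.
move=> psiS; have [psi1 psiM] := psiS; split; first by rewrite invg1 psi1 conjc1.
move=> x y; transitivity (cj (\sum_(h : H) psi (y^-1 * x^-1 ^ h)%g)).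
  rewrite rmorph_sum (reindex_inj invg_inj) /=; apply: eq_bigr => h _.
  congr (cj _); rewrite -[RHS](spherical_class psiS _ h^-1)%g.
  by congr (psi _); gsimp.
by rewrite psiM !rmorphM /= rmorph_nat mulrAC.
Qed.

Lemma spherical_mass_gt0 psi : spherical psi -> 0 < \sum_x nrm (psi x) ^+ 2.
Proof.
move=> [psi1 _]; rewrite (bigD1 1%g) //= psi1 ComplexField.Normc.normc1 expr1n.
by rewrite ltr_pwDl ?ltr01 // sumr_ge0 // => x _; rewrite sqr_ge0.
Qed.

(* [psi] and its adjoint are both eigenfunctions of convolution, for the same
   nonzero eigenvalue, and convolution of class functions is commutative. *)
Lemma spherical_inv psi x : spherical psi -> psi x^-1%g = cj (psi x).
Proof.
move=> psiS; have [psi1 psiM] := psiS; have aS := spherical_adj psiS.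
have psiJ := spherical_class psiS.
set f := (fun x => cj (psi x^-1%g)) in aS; have aJ := spherical_class aS.
set s := (\sum_x nrm (psi x) ^+ 2)%:C.
have s0 : s != 0.
  by rewrite eq_complex /= eqxx andbT gt_eqF ?spherical_mass_gt0.
have E1 z : \sum_y psi (z * y^-1)%g * f y = psi z * s.
  rewrite (spherical_convol psiS aJ); congr (_ * _).
  rewrite (reindex_inj invg_inj) /s rmorph_sum /=; apply: eq_bigr => y _.
  by rewrite /f invgK mulcJ.
have E2 z : \sum_y f (z * y^-1)%g * psi y = f z * s.
  rewrite (spherical_convol aS psiJ); congr (_ * _).
  rewrite /s rmorph_sum /=; apply: eq_bigr => y _.
  by rewrite /f invgK mulrC mulcJ.
have {}E1 : psi x^-1%g = f x^-1%g.
  apply: (mulIf s0); rewrite -E1 -E2.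
  rewrite (reindex_inj invg_inj) (reindex_inj (mulgI x)) /=.
  apply: eq_bigr => y _; rewrite invgK mulrC; congr (_ * _).
    by rewrite -[RHS](aJ _ x^-1)%g; congr (f _); gsimp.
  by rewrite mulKg.
by rewrite E1 /f invgK.
Qed.

Section PositiveDefinite.
Variable psi : H -> R[i].
Hypothesis psiS : spherical psi.
Let N : R := \sum_x nrm (psi x) ^+ 2.
Let beta y z := psi (z * y)%g - psi y * psi z.

Lemma spherical_convol_self x : \sum_y psi (x * y^-1)%g * psi y = psi x * N%:C.
Proof.
rewrite spherical_convol //; last exact: spherical_class.
congr (_ * _); rewrite /N rmorph_sum; apply: eq_bigr => y _.
by rewrite spherical_inv // mulrC mulcJ.
Qed.

(** The convolution of [psi] with itself is [N * psi], so the right translates of [psi] have Gram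
    matrix [N * psi (x^-1 * y)]. As a function of [z], [beta x] is the translate by [x] minus its
    orthogonal projection on the line of [psi]. *)
Lemma spherical_gram x y :
  \sum_z (cj (beta x z)) * beta y z = N%:C * (psi (x^-1 * y)%g - psi x^-1%g * psi y).
Proof.
have gram u v : \sum_z (cj (psi (z * u)%g)) * psi (z * v)%g = N%:C * psi (u^-1 * v)%g.
  rewrite [RHS]mulrC -spherical_convol_self (reindex_inj (mulIg v^-1)%g) /=.
  apply: eq_bigr => z _; rewrite -(spherical_inv _ psiS).
  by congr (psi _ * psi _); gsimp.
have gramu u : \sum_z (cj (psi (z * u)%g)) * psi z = N%:C * psi u^-1%g.
  rewrite -[u^-1%g]mulg1 -gram; apply: eq_bigr => z _; by rewrite mulg1.
have gramv v : \sum_z (cj (psi z)) * psi (z * v)%g = N%:C * psi v.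
  rewrite -[v in RHS]mul1g -[1%g in RHS]invg1 -gram; apply: eq_bigr => z _.
  by rewrite mulg1.
have gram1 : \sum_z (cj (psi z)) * psi z = N%:C.
  by rewrite -[RHS]mulr1 -psiS.1 -gramv; apply: eq_bigr => z _; rewrite mulg1.
transitivity (\sum_z (cj (psi (z * x)%g)) * psi (z * y)%g
  - psi y * (\sum_z (cj (psi (z * x)%g)) * psi z)
  - (cj (psi x)) * (\sum_z (cj (psi z)) * psi (z * y)%g)
  + (cj (psi x)) * psi y * (\sum_z (cj (psi z)) * psi z)).
  rewrite !mulr_sumr -!sumrB -big_split /=; apply: eq_bigr => z _.
  rewrite /beta rmorphB rmorphM /=; ring.
rewrite gram gramu gramv gram1 (spherical_inv _ psiS); ring.
Qed.

(** Up to the factor [N], the difference is the Gram entry of [beta x^-1] and [beta y]. It is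
    bounded termwise by [u v <= (u^2 + v^2) / 2], the square norm of [beta u] being
    [N (1 - |psi u|^2)]. *)
Lemma spherical_mul_near x y :
  nrm (psi (x * y)%g - psi x * psi y) <=
  1 - (nrm (psi x) ^+ 2 + nrm (psi y) ^+ 2) / 2.
Proof.
have N0 : 0 < N := spherical_mass_gt0 psiS.
have nV u : nrm (psi u^-1%g) = nrm (psi u) by rewrite spherical_inv ?normc_conj.
have nbeta u : \sum_z nrm (beta u z) ^+ 2 = N * (1 - nrm (psi u) ^+ 2).
  apply: (@complexI R); rewrite rmorph_sum rmorphM rmorphB rmorph1 /= -mulcJ.
  rewrite [_ * cj _]mulrC -(spherical_inv _ psiS).
  have := spherical_gram u u; rewrite mulVg psiS.1 => <-.
  by apply: eq_bigr => z _; rewrite -mulcJ mulrC.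
rewrite -(ler_pM2l N0) -{1}(normc_real (ltW N0)) -ComplexField.Normc.normcM.
have := spherical_gram x^-1 y; rewrite invgK => <-.
apply: le_trans (normc_sum _ _ _) _.
have -> : N * (1 - (nrm (psi x) ^+ 2 + nrm (psi y) ^+ 2) / 2) =
    (\sum_z (nrm (beta x^-1 z) ^+ 2 + nrm (beta y z) ^+ 2)) / 2.
  by rewrite big_split /= !nbeta nV; field.
rewrite mulr_suml; apply: ler_sum => z _.
rewrite ComplexField.Normc.normcM normc_conj.
have := sqr_ge0 (nrm (beta x^-1 z) - nrm (beta y z)); lra.
Qed.

(** The square norm of [beta y] is [N (1 - |psi y|^2) = 0], so [beta y] vanishes everywhere. *)
Lemma spherical_mul_eq x y :
  nrm (psi y) = 1 -> psi (x * y)%g = psi x * psi y.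
Proof.
move=> ny1; apply/eqP; rewrite -subr_eq0 -normc_eq0 -sqrf_eq0.
have : \sum_z nrm (beta y z) ^+ 2 = 0.
  apply: (@complexI R); rewrite rmorph_sum /=.
  transitivity (N%:C * (psi (y^-1 * y)%g - psi y^-1%g * psi y)).
    rewrite -spherical_gram.
    by apply: eq_bigr => z _; rewrite -mulcJ mulrC.
  rewrite mulVg psiS.1 (spherical_inv _ psiS) mulrC [cj _ * _]mulrC mulcJ ny1.
  by rewrite expr1n subrr mul0r.
move/eqP; rewrite psumr_eq0 => [/allP/(_ x)|z _]; last exact: sqr_ge0.
by rewrite mem_index_enum /beta mulrC => /(_ isT).
Qed.

(** For [y = x] the bound in [spherical_mul_near] is [1 - |psi x|^2], which must be nonnegative. *)
Lemma spherical_norm_le1 x : nrm (psi x) <= 1.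
Proof.
have := le_trans (normc_ge0 _) (spherical_mul_near x x).
have := normc_ge0 (psi x); nra.
Qed.

Lemma spherical_norm_mul x y :
  (nrm (psi x) + nrm (psi y)) ^+ 2 / 2 - 1 <= nrm (psi (x * y)%g).
Proof.
have := spherical_mul_near x y.
have : nrm (psi x) * nrm (psi y) <=
    nrm (psi (x * y)%g) + nrm (psi (x * y)%g - psi x * psi y).
  rewrite -ComplexField.Normc.normcM -[X in _ + X]normcN.
  by apply: le_trans (le_normcD _ _); rewrite opprB addrCA subrr addr0.
nra.
Qed.

End PositiveDefinite.

End Spherical.

(** * The gap: an idempotent of norm close to 1 has norm 1 *)

Section Gap.
Local Open Scope complex_scope.
Variables (R : rcfType) (H : finGroupType).
Implicit Types (x y : H).
Variable psi : H -> R[i].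
Hypothesis psiS : spherical psi.
Let a x : R := nrm (psi x).
Let N : R := \sum_x a x ^+ 2.
(** This bounds the norm of the idempotent [psi / N] by [1 + 1 / 1000]. *)
Hypothesis small : \sum_x a x <= (1 + 1 / 1000) * N.

Let N_gt0 : 0 < N. Proof. exact: spherical_mass_gt0. Qed.
Let a_ge0 x : 0 <= a x. Proof. exact: normc_ge0. Qed.
Let a_le1 x : a x <= 1. Proof. exact: spherical_norm_le1. Qed.
Let aV x : a x^-1%g = a x.
Proof. by rewrite /a spherical_inv // normc_conj. Qed.
Let aJ x y : a (x ^ y)%g = a x.
Proof. by rewrite /a spherical_class. Qed.
Let aM x y : (a x + a y) ^+ 2 / 2 - 1 <= a (x * y)%g.
Proof. exact: spherical_norm_mul. Qed.

(** The terms are nonnegative, and over all of [H] they add up to [\sum_x a x - N]. *)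
Let defect_le (P : pred H) : \sum_(x | P x) a x * (1 - a x) <= N / 1000.
Proof.
have -> : N / 1000 = (1 + 1 / 1000) * N - N by field.
apply: le_trans (_ : \sum_x a x * (1 - a x) <= _).
  rewrite [leRHS](bigID P) /= lerDl sumr_ge0 // => x _.
  by rewrite mulr_ge0 ?subr_ge0.
rewrite (eq_bigr (fun x => a x - a x ^+ 2)); last by move=> x _; ring.
by rewrite sumrB lerD2r.
Qed.

Let S := [set x | 99 / 100 <= a x].

(** On the annulus [a (1 - a)] is at least its value 99/10000 at the outer end, and 10/99 <
    102/1000. *)
Let card_annulus :
  #|[set x | (67 / 100 <= a x) && (a x < 99 / 100)]|%:R <= N * (102 / 1000).
Proof.
set B := [set x | _].
have D : \sum_(x in B) a x * (1 - a x) <= N / 1000 := defect_le _.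
have : \sum_(x in B) (99 / 10000 : R) <= \sum_(x in B) a x * (1 - a x).
  by apply: ler_sum => x; rewrite inE => /andP[]; nra.
by move: D N_gt0; rewrite sumr_const -[_ *+ #|_|]mulr_natr; lra.
Qed.

(** Off [S], [a <= 99 (1 - a)], so at most 99/1000 of the mass [N] lies there; on [S] each point
    carries mass at most 1. *)
Let card_core : N * (9 / 10) <= #|S|%:R.
Proof.
have D : \sum_(x | x \notin S) a x * (1 - a x) <= N / 1000 := defect_le _.
have E : N = \sum_(x in S) a x ^+ 2 + \sum_(x | x \notin S) a x ^+ 2.
  by rewrite /N (bigID (mem S)).
have : \sum_(x | x \notin S) a x ^+ 2 <= \sum_(x | x \notin S) 99 * (a x * (1 - a x)).
  apply: ler_sum => x; rewrite inE -ltNge; have := a_ge0 x; nra.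
have : \sum_(x in S) a x ^+ 2 <= \sum_(x in S) 1.
  by apply: ler_sum => x _; rewrite expr_le1.
rewrite sumr_const -mulr_sumr; have := N_gt0; move: E D; lra.
Qed.

(* [x S] cannot fit in the thin annulus around [S], so it meets [S]. *)
Let core_closed x : 84 / 100 <= a x -> 96 / 100 <= a x.
Proof.
move=> ax; suff [s [sS xsS]] : exists s, s \in S /\ (x * s)%g \in S.
  (* Both moduli are at least 99/100, and [(198/100)^2 / 2 - 1 > 96/100]. *)
  have := aM (x * s) s^-1%g; rewrite mulgK aV.
  move: sS xsS; rewrite !inE; nra.
case: (pickP [pred s | (s \in S) && ((x * s)%g \in S)]) => [s /andP[? ?]|nS].
  by exists s.
(* Translation by [x] would send [S] to points off [S] of modulus at least
   [(84/100 + 99/100)^2 / 2 - 1 > 67/100], but 102/1000 < 9/10. *)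
have : (#|S| <= #|[set x | (67 / 100 <= a x)%R && (a x < 99 / 100)%R]|)%N.
  rewrite -(card_imset _ (mulgI x)); apply/subset_leq_card.
  apply/fintype.subsetP => _ /imsetP[s sS ->]; have := nS s; rewrite /= sS /= !inE => /negbT.
  rewrite -ltNge => ->; rewrite andbT; have := aM x s.
  by move: sS; rewrite inE; nra.
rewrite -(ler_nat R); move: card_annulus card_core N_gt0; lra.
Qed.

(* At a minimizer [x] of [a] on the core, the values [psi (x * x ^ h)] have
   mean [psi x ^+ 2], lie close to it and have modulus at least [a x]. *)
Let core_unimodular x : 96 / 100 <= a x -> a x = 1.
Proof.
move=> ax; have [x0 ax0 min_x0] :
    exists2 x, 96 / 100 <= a x & forall y, 96 / 100 <= a y -> a x <= a y.
  have := @arg_minP _ R H x [pred y | 96 / 100 <= a y] a ax.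
  by case=> x0 ? min_x0; exists x0.
suff: a x0 = 1 by move=> E; apply/le_anti; rewrite a_le1 -E min_x0.
pose m := a x0 ^+ 2; pose c := psi x0 ^+ 2; pose v h := psi (x0 * x0 ^ h)%g.
have nc : nrm c = m by rewrite /c !expr2 ComplexField.Normc.normcM.
have vc h : nrm (v h - c) <= 1 - m.
  have := spherical_mul_near psiS x0 (x0 ^ h); rewrite (spherical_class psiS) -expr2.
  by rewrite -/c -/(v h) -/(a x0) -/m; lra.
have vm h : m <= nrm (v h) ^+ 2.
  (* As [(192/100)^2 / 2 - 1 > 84/100], the product is back in the core, where [x0] is minimal. *)
  rewrite ler_sqr ?nnegrE ?a_ge0 //; apply: min_x0; apply: core_closed.
  by have := aM x0 (x0 ^ h)%g; rewrite aJ; move: ax0; nra.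
have H0 : 0 < #|H|%:R :> R by rewrite ltr0n; apply/card_gt0P; exists 1%g.
(* The variance identity: by the functional equation [c] is the mean of [v], and its modulus is
   [m]. *)
have : \sum_(h : H) nrm (v h - c) ^+ 2 = \sum_(h : H) nrm (v h) ^+ 2 - #|H|%:R * m ^+ 2.
  rewrite (eq_bigr (fun h => nrm (v h) ^+ 2 + (m ^+ 2 - 2 * complex.Re (v h * cj c)))).
    rewrite big_split sumrB /= sumr_const -mulr_sumr -raddf_sum -mulr_suml.
    rewrite (_ : \sum_h v h = #|H|%:R * c); last by rewrite psiS.2 -mulrA.
    rewrite -mulrA mulcJ nc -(rmorph_nat (real_complex R)) -rmorphM /=.
    rewrite (_ : #|xpredT| = #|H|); last exact: eq_card.
    by rewrite -[_ *+ #|_|]mulr_natl; ring.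
  by move=> h _; rewrite normcB_sqr nc addrA.
have cst (r : R) : \sum_(h : H) r = #|H|%:R * r by rewrite sumr_const mulr_natl.
have : \sum_(h : H) nrm (v h - c) ^+ 2 <= #|H|%:R * (1 - m) ^+ 2.
  rewrite -cst; apply: ler_sum => h _; rewrite ler_sqr ?nnegrE ?normc_ge0 //.
  exact: le_trans (normc_ge0 _) (vc h).
have : #|H|%:R * m <= \sum_(h : H) nrm (v h) ^+ 2 by rewrite -cst; apply: ler_sum.
move=> A1 A2 A3; have : #|H|%:R * (m - m ^+ 2) <= #|H|%:R * (1 - m) ^+ 2.
  by rewrite mulrBr; apply: le_trans _ A2; rewrite A3 lerD2r.
rewrite ler_pM2l // => mm; apply/le_anti; rewrite a_le1 leNgt; apply/negP => a1.
have [m_lt1 m_gt] : m < 1 /\ 9 / 10 < m by split; rewrite /m expr2; nra.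
(* This product equals [(m - m^2) - (1 - m)^2], which [mm] makes nonpositive. *)
have : 0 < (1 - m) * (2 * m - 1) by apply: mulr_gt0; lra.
by move: mm; lra.
Qed.

(** For a normalized character this is the centre of the character. By the two preceding facts, [a]
    has no value in [[84/100, 1)]. *)
Let Z := [set x | a x == 1].

Let off_center x : x \notin Z -> a x < 84 / 100.
Proof.
by rewrite inE ltNge; apply: contra => /core_closed/core_unimodular/eqP.
Qed.

Let mulZ x z : z \in Z -> psi (x * z)%g = psi x * psi z.
Proof. by rewrite inE => /eqP; exact: spherical_mul_eq. Qed.

(** Off [Z], [1 - a > 16/100], hence [a <= 10 a (1 - a)]. *)
Let sum_off : \sum_(x | x \notin Z) a x <= N / 100.
Proof.
have D : \sum_(x | x \notin Z) a x * (1 - a x) <= N / 1000 := defect_le _.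
have : \sum_(x | x \notin Z) a x <= \sum_(x | x \notin Z) 10 * (a x * (1 - a x)).
  apply: ler_sum => x /off_center; have := a_ge0 x; nra.
by rewrite -mulr_sumr; move: D; lra.
Qed.

Let card_center : N * (99 / 100) <= #|Z|%:R.
Proof.
have E : N = \sum_(x in Z) a x ^+ 2 + \sum_(x | x \notin Z) a x ^+ 2.
  by rewrite /N (bigID (mem Z)).
have : \sum_(x | x \notin Z) a x ^+ 2 <= \sum_(x | x \notin Z) a x.
  by apply: ler_sum => x _; have := a_ge0 x; have := a_le1 x; nra.
have : \sum_(x in Z) a x ^+ 2 = #|Z|%:R.
  rewrite -sum1_card natr_sum; apply: eq_bigr => x; rewrite inE => /eqP ->.
  by rewrite expr1n.
by have := sum_off; move: E; lra.
Qed.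

(* Convolving [psi] with itself at a maximizer [x] of [a] off [Z]: the two
   blocks [y \in Z] and [x * y^-1 \in Z] each contribute [#|Z| * psi x]. *)
Let off_center0 x : x \notin Z -> a x = 0.
Proof.
move=> xZ; have [x0 x0Z max_x0] :
    exists2 x, x \notin Z & forall y, y \notin Z -> a y <= a x.
  have := @arg_maxP _ R H x [pred y | y \notin Z] a xZ.
  by case=> x0 ? max_x0; exists x0.
suff: a x0 = 0 by move=> E; apply/le_anti; rewrite a_ge0 -E max_x0.
have ZV y : (y^-1%g \in Z) = (y \in Z) by rewrite !inE aV.
have ZM y z : z \in Z -> ((y * z)%g \in Z) = (y \in Z).
  move=> zZ; rewrite !inE /a mulZ // ComplexField.Normc.normcM.
  by move: zZ; rewrite inE /a => /eqP ->; rewrite mulr1.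
pose F y := psi (x0 * y^-1)%g * psi y.
have FZ y : y \in Z -> F y = psi x0.
  move=> yZ; rewrite /F mulZ ?ZV // (spherical_inv _ psiS) -mulrA [cj _ * _]mulrC.
  by rewrite mulcJ; move: yZ; rewrite inE /a => /eqP ->; rewrite expr1n mulr1.
have FZ' y : (x0 * y^-1)%g \in Z -> F y = psi x0.
  move=> yZ; rewrite -[RHS](spherical_class psiS _ y^-1)%g.
  by rewrite /F mulrC -mulZ //; congr (psi _); gsimp.
(* The second block is the set of all [z^-1 * x0] with [z] in [Z]; it is disjoint from [Z] because
   [x0] lies off [Z]. *)
have E : psi x0 * N%:C = psi x0 *+ #|Z| + (psi x0 *+ #|Z| +
    \sum_(y | (y \notin Z) && ((x0 * y^-1)%g \notin Z)) F y).
  rewrite -(spherical_convol_self psiS) (bigID (mem Z)) /=; congr (_ + _).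
    by rewrite -sumr_const; apply: eq_bigr => y /FZ.
  rewrite (bigID [pred y | (x0 * y^-1)%g \in Z]) /=; congr (_ + _).
  rewrite (eq_bigr (fun=> psi x0)) => [|y /andP[_ /FZ'] //].
  rewrite (reindex_inj invg_inj) (reindex_inj (mulgI x0^-1)%g) /=.
  rewrite -sumr_const; apply: eq_bigl => y; rewrite invgK mulKVg.
  rewrite ZV; case yZ: (y \in Z); rewrite ?andbF // andbT ZM //.
  by rewrite ZV.
(* By maximality of [x0] each remaining term has modulus at most [a x0 * a y], and [sum_off] bounds
   their sum. Since [2 #|Z| - N >= (98/100) N], this is possible only for [a x0 = 0]. *)
have : a x0 * (2 * #|Z|%:R - N) <= a x0 * (N / 100).
  have <- : nrm (psi x0 * (2 * #|Z|%:R - N)%:C) = a x0 * (2 * #|Z|%:R - N).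
    rewrite ComplexField.Normc.normcM normc_real // subr_ge0.
    by move: card_center N_gt0; lra.
  rewrite (_ : psi x0 * _ =
    - \sum_(y | (y \notin Z) && ((x0 * y^-1)%g \notin Z)) F y); last first.
    move: E; set s := \sum_(y | _) _ => E.
    rewrite rmorphB rmorphM /= !rmorph_nat mulrBr E -mulr_natr; ring.
  rewrite normcN; apply: le_trans (normc_sum _ _ _) _.
  apply: (@le_trans _ _ (\sum_(y | y \notin Z) a x0 * a y)); last first.
    by rewrite -mulr_sumr ler_wpM2l ?a_ge0.
  rewrite [leRHS](bigID [pred y | (x0 * y^-1)%g \in Z]) /=.
  rewrite -[leLHS]add0r lerD ?sumr_ge0 // => [y _|]; first by rewrite mulr_ge0.
  apply: ler_sum => y /andP[_ /max_x0 xy].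
  rewrite /F ComplexField.Normc.normcM; apply: ler_wpM2r xy; exact: normc_ge0.
have := a_ge0 x0; rewrite le_eqVlt => /orP[/eqP <- //|a0].
rewrite ler_pM2l //; move: card_center N_gt0; lra.
Qed.

(** The modulus only takes the values 0 and 1. Divided by [N], the equality says that the idempotent
    has norm exactly 1. *)
Lemma spherical_gap : \sum_x nrm (psi x) = \sum_x nrm (psi x) ^+ 2.
Proof.
apply: eq_bigr => x _; rewrite -/(a x).
have [|/off_center0 ->] := boolP (x \in Z); last by rewrite expr0n.
by rewrite inE => /eqP ->; rewrite expr1n.
Qed.

End Gap.

(** * Irreducible characters *)

Section Schur.
Variables (R : rcfType) (gT : finGroupType) (n : nat).
Variable rG : mx_representation R[i] [set: gT]%G n.
Hypothesis irrG : mx_irreducible rG.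

Lemma irr_degree_gt0 : (0 < n)%N.
Proof. by have /mx_irrP[] := irrG. Qed.

Lemma irr_degree_neq0 : n%:R != 0 :> R[i].
Proof. by rewrite pnatr_eq0 -lt0n irr_degree_gt0. Qed.

(** Schur's lemma: [R[i]] is algebraically closed, so irreducibility is absolute, and the trace
    determines the scalar. *)
Lemma irr_centralizer_scalar (A : 'M[R[i]]_n) :
  (forall x, rG x *m A = A *m rG x) -> A = (\tr A / n%:R)%:M.
Proof.
move=> cA; suff /is_scalar_mxP[a ->] : is_scalar_mx A.
  by rewrite mxtrace_scalar -[a *+ n]mulr_natr mulfK // irr_degree_neq0.
have absG : mx_absolutely_irreducible rG.
  exact: (@group_closure_closed_field R[i] gT).
apply: (mx_abs_irr_cent_scalar absG).
by apply/centgmxP => x _; rewrite cA.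
Qed.

Lemma irr_average (A : 'M[R[i]]_n) :
  \sum_(h : gT) rG h *m A *m rG h^-1%g = (#|gT|%:R * \tr A / n%:R)%:M.
Proof.
rewrite [LHS]irr_centralizer_scalar => [|x].
  congr (_ / _)%:M; rewrite raddf_sum /= (eq_bigr (fun=> \tr A)) => [|h _].
    by rewrite sumr_const mulr_natl.
  by rewrite mxtrace_mulC mulmxA -repr_mxM ?inE // mulVg repr_mx1 mul1mx.
rewrite mulmx_sumr mulmx_suml (reindex_inj (mulgI x^-1)%g) /=.
apply: eq_bigr => h _; rewrite invMg invgK !mulmxA -!repr_mxM ?inE //.
by rewrite mulKVg -!mulmxA -!repr_mxM ?inE.
Qed.

Lemma irr_char_class_convol x y :
  \sum_(h : gT) \tr (rG (x * y ^ h)%g) =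
  #|gT|%:R * \tr (rG x) * \tr (rG y) / n%:R.
Proof.
transitivity (\tr (rG x *m \sum_(h : gT) rG h *m rG y *m rG h^-1%g)).
  rewrite mulmx_sumr raddf_sum (reindex_inj invg_inj) /=; apply: eq_bigr => h _.
  by rewrite -!repr_mxM ?inE // conjgE invgK !mulgA.
rewrite irr_average mul_mx_scalar mxtraceZ; ring.
Qed.

(** The product of the two traces is the sum over [i], [k] of the [(i, k)] entries of
    [rG h *m delta_mx i k *m rG h^-1]. By [irr_average] only [i = k] contributes. *)
Lemma irr_char_orthonormal :
  \sum_(x : gT) \tr (rG x) * \tr (rG x^-1%g) = #|gT|%:R.
Proof.
transitivity (\sum_i \sum_k
    (\sum_(h : gT) rG h *m delta_mx i k *m rG h^-1%g) i k).
  under eq_bigr do rewrite /mxtrace mulr_suml.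
  under eq_bigr do under eq_bigr do rewrite mulr_sumr.
  rewrite exchange_big /=; apply: eq_bigr => i _.
  rewrite exchange_big /=; apply: eq_bigr => k _.
  rewrite summxE; apply: eq_bigr => h _.
  rewrite -(mul_delta_mx (ord0 : 'I_1)) mulmxA -colE -mulmxA -rowE mxE.
  by rewrite big_ord1 !mxE.
rewrite (eq_bigr (fun=> #|gT|%:R / n%:R)) => [|i _].
  by rewrite sumr_const card_ord -[_ *+ n]mulr_natr mulfVK ?irr_degree_neq0.
have tr_delta : \tr (delta_mx i i : 'M[R[i]]_n) = 1.
  rewrite /mxtrace (bigD1 i) //= mxE !eqxx big1 ?addr0 // => j /negPf ji.
  by rewrite mxE ji.
under eq_bigr do rewrite irr_average mxE.
rewrite (bigD1 i) //= big1 => [|k]; first by rewrite addr0 eqxx tr_delta mulr1.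
by rewrite eq_sym => /negPf ->.
Qed.

End Schur.

Section IrreducibleCharacter.
Variables (R : realType) (gT : finGroupType) (chi : gT -> R[i]).
Hypothesis irr_chi : irr_group_character chi.

Lemma irr_character_degree : exists2 n, (0 < n)%N & chi 1%g = n%:R.
Proof.
have [n [rG [irrG chiE]]] := irr_chi; exists n; first exact: irr_degree_gt0 irrG.
by rewrite chiE repr_mx1 mxtrace1.
Qed.

Lemma irr_character_spherical : spherical (fun x => chi x / chi 1%g).
Proof.
have [n [rG [irrG chiE]]] := irr_chi.
have -> : chi 1%g = n%:R by rewrite chiE repr_mx1 mxtrace1.
have n0 := irr_degree_neq0 irrG; split.
  by rewrite chiE repr_mx1 mxtrace1 divff.
move=> x y; rewrite -mulr_suml; under eq_bigr do rewrite chiE.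
by rewrite irr_char_class_convol // !chiE; field.
Qed.

(** This comes from the functional equation, the degree being real, rather than from an invariant
    inner product. *)
Lemma irr_character_inv x : chi x^-1%g = cj (chi x).
Proof.
have [n n0 chi1] := irr_character_degree.
have := spherical_inv x irr_character_spherical.
rewrite chi1 rmorphM fmorphV /= rmorph_nat => /(congr1 ( *%R^~ n%:R)) /=.
by rewrite !mulfVK // pnatr_eq0 -lt0n.
Qed.

Lemma irr_character_norm2 : \sum_x nrm (chi x) ^+ 2 = #|gT|%:R.
Proof.
apply: (@complexI R); rewrite rmorph_sum rmorph_nat /=.
have [n [rG [irrG chiE]]] := irr_chi; rewrite -(irr_char_orthonormal irrG).
by apply: eq_bigr => x _; rewrite -mulcJ -irr_character_inv !chiE.
Qed.

End IrreducibleCharacter.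

(** * Convolution on [ell1] *)

Local Open Scope classical_set_scope.
Local Open Scope ring_scope.

Section UnconditionalSums.
Variables (R : realType) (X : choiceType).
Implicit Types (f g : X -> R[i]) (s : R[i]) (M : R).

(** Real bounds on finite sums replace sums in the extended reals; [norm1_bounded], [bounded_ell1]
    and [norm1_le] translate between the two. *)
Definition abs_bounded f M := forall A : {fset X}, \sum_(x <- A) nrm (f x) <= M.

(** Unconditional convergence with a real tolerance; [sum_has_sum] links it to [summability.sum]. *)
Definition has_sum f s := forall e : R, 0 < e ->
  exists A : {fset X}, forall B : {fset X}, (A `<=` B)%fset ->
    nrm (\sum_(x <- B) f x - s) < e.

Lemma abs_bounded_le f M M' : M <= M' -> abs_bounded f M -> abs_bounded f M'.
Proof. by move=> MM' fM A; exact: le_trans (fM A) MM'. Qed.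

Lemma abs_bounded_term f M x : abs_bounded f M -> nrm (f x) <= M.
Proof. by move/(_ [fset x]%fset); rewrite big_seq_fset1. Qed.

Lemma abs_bounded_seq f M (s : seq X) :
  uniq s -> abs_bounded f M -> \sum_(x <- s) nrm (f x) <= M.
Proof.
move=> us /(_ [fset x in s]%fset); congr (_ <= _); apply: perm_big.
by apply: uniq_perm => // x; rewrite inE.
Qed.

Lemma abs_bounded_comp f M (h : X -> X) :
  injective h -> abs_bounded f M -> abs_bounded (f \o h) M.
Proof.
move=> h_inj fM A; rewrite -(big_map h xpredT (fun x => nrm (f x))).
by apply: abs_bounded_seq => //; rewrite map_inj_uniq.
Qed.

Lemma abs_bounded_dom f g M :
  (forall x, nrm (f x) <= nrm (g x)) -> abs_bounded g M -> abs_bounded f M.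
Proof.
move=> fg gM A; apply: le_trans (gM A); apply: ler_sum => x _; exact: fg.
Qed.

Lemma abs_bounded_fset f (A : {fset X}) :
  (forall x, x \notin A -> f x = 0) -> abs_bounded f (\sum_(x <- A) nrm (f x)).
Proof.
move=> fA B.
rewrite (big_fsetID _ (mem A)) /= [X in _ + X]big1_fset ?addr0 => [|x]; last first.
  by rewrite !inE => /andP[_ /fA ->]; rewrite ComplexField.Normc.normc0.
rewrite [leRHS](big_fsetID _ (mem B)) /=.
rewrite (_ : [fset x | x in B & x \in A]%fset = [fset x | x in A & x \in B]%fset).
  by rewrite lerDl sumr_ge0 // => x _; rewrite normc_ge0.
by apply/fsetP => x; rewrite !inE andbC.
Qed.

Lemma abs_boundedD f g M K :
  abs_bounded f M -> abs_bounded g K -> abs_bounded (f \+ g) (M + K).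
Proof.
move=> fM gK A; apply: le_trans (lerD (fM A) (gK A)).
by rewrite -big_split; apply: ler_sum => x _; exact: le_normcD.
Qed.

Lemma abs_boundedZ f M (a : R[i]) :
  abs_bounded f M -> abs_bounded (a \*o f) (nrm a * M).
Proof.
move=> fM A; under eq_bigr do rewrite ComplexField.Normc.normcM.
by rewrite -mulr_sumr ler_wpM2l ?normc_ge0.
Qed.

Lemma has_sumD f g s t : has_sum f s -> has_sum g t -> has_sum (f \+ g) (s + t).
Proof.
move=> fs gt e e0; have e2 : 0 < e / 2 by rewrite divr_gt0.
have [A fA] := fs _ e2; have [B gB] := gt _ e2.
exists (A `|` B)%fset => D; rewrite fsubUset => /andP[/fA fD /gB gD].
rewrite big_split /= opprD addrACA [e]splitr.
exact: le_lt_trans (le_normcD _ _) (ltrD fD gD).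
Qed.

Lemma has_sumZ f s a : has_sum f s -> has_sum (a \*o f) (a * s).
Proof.
move=> fs e e0; have a0 : 0 < 1 + nrm a by rewrite ltr_pwDl ?normc_ge0.
have [A fA] := fs _ (divr_gt0 e0 a0).
exists A => B /fA fB; rewrite -mulr_sumr -mulrBr ComplexField.Normc.normcM.
move: fB; rewrite ltr_pdivlMr // => fB; apply: le_lt_trans fB.
by rewrite mulrC ler_wpM2l ?normc_ge0 // lerDr.
Qed.

Lemma has_sum_fset f (A : {fset X}) :
  (forall x, x \notin A -> f x = 0) -> has_sum f (\sum_(x <- A) f x).
Proof.
move=> fA e e0; exists A => B AB; rewrite (big_fsetID _ (mem A)) /=.
rewrite [X in _ + X - _]big1_fset ?addr0; last first.
  by move=> x; rewrite !inE => /andP[_ /fA ->].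
rewrite (_ : [fset x | x in B & x \in A]%fset = A) ?subrr.
  by rewrite ComplexField.Normc.normc0.
apply/fsetP => x; rewrite !inE /=; case: (boolP (x \in A)) => xA; last by rewrite andbF.
by rewrite (fsubsetP AB).
Qed.

Lemma has_sum_comp f s (h k : X -> X) :
  cancel h k -> cancel k h -> has_sum f s -> has_sum (f \o h) s.
Proof.
move=> hK kK fs e /fs[A fA]; exists (k @` A)%fset => B kAB.
have -> : \sum_(x <- B) (f \o h) x = \sum_(x <- (h @` B)%fset) f x.
  by rewrite big_imfset //= => x y _ _; exact: can_inj hK x y.
apply: fA; apply/fsubsetP => x xA; apply/imfsetP; exists (k x) => //=.
by apply: (fsubsetP kAB); apply/imfsetP; exists x.
Qed.

Let has_sum_nonneg (g : X -> R) M : (forall x, 0 <= g x) ->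
  (forall A : {fset X}, \sum_(x <- A) g x <= M) ->
  exists s, has_sum (fun x => (g x)%:C%C) s.
Proof.
move=> g0 gM; pose S := [set \sum_(x <- A) g x | A in [set: {fset X}]].
have hS : has_sup S.
  split; first by exists (\sum_(x <- fset0) g x), fset0.
  by exists M => _ [A _ <-].
exists (sup S)%:C%C => e e0; have [_ [A _ <-] gA] := sup_adherent e0 hS.
exists A => B AB; rewrite -rmorph_sum -rmorphB /= expr0n addr0 sqrtr_sqr.
have BS : \sum_(x <- B) g x <= sup S by apply: sup_ubound; [case: hS | exists B].
rewrite ler0_norm ?subr_le0 // opprB ltrBlDr addrC -ltrBlDr.
apply: lt_le_trans gA _; rewrite [leRHS](big_fsetID _ (mem A)) /=.
rewrite (_ : [fset x | x in B & x \in A]%fset = A) ?lerDl ?sumr_ge0 //.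
apply/fsetP => x; rewrite !inE /=; case: (boolP (x \in A)) => xA; last by rewrite andbF.
by rewrite (fsubsetP AB).
Qed.

(** The positive and negative parts of the real and imaginary parts are nonnegative families
    dominated by [nrm (f x)]; each sums to the supremum of its finite sums. *)
Lemma abs_bounded_has_sum f M : abs_bounded f M -> exists s, has_sum f s.
Proof.
move=> fM; pose pos (r : R) := Num.max r 0.
have pos_sum (u : X -> R) : (forall x, `|u x| <= nrm (f x)) ->
    exists s, has_sum (fun x => (pos (u x))%:C%C) s.
  move=> uf; apply: (has_sum_nonneg (M := M)) => [x|A].
    by rewrite /pos le_max lexx orbT.
  apply: le_trans (fM A); apply: ler_sum => x _; apply: le_trans (uf x).
  by rewrite /pos ge_max ler_norm normr_ge0.
have re_le (z : R[i]) : `|complex.Re z| <= nrm z.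
  by case: z => a b /=; rewrite -sqrtr_sqr ler_wsqrtr // lerDl sqr_ge0.
have im_le (z : R[i]) : `|complex.Im z| <= nrm z.
  by case: z => a b /=; rewrite -sqrtr_sqr ler_wsqrtr // lerDr sqr_ge0.
have re_leN x : `|- complex.Re (f x)| <= nrm (f x) by rewrite normrN re_le.
have im_leN x : `|- complex.Im (f x)| <= nrm (f x) by rewrite normrN im_le.
have [s1 f1] := pos_sum _ (fun x => re_le (f x)).
have [s2 f2] := pos_sum _ re_leN.
have [s3 f3] := pos_sum _ (fun x => im_le (f x)).
have [s4 f4] := pos_sum _ im_leN.
exists ((s1 + -1 * s2) + 'i%C * (s3 + -1 * s4)).
have := has_sumD (has_sumD f1 (has_sumZ (-1) f2))
  (has_sumZ 'i%C (has_sumD f3 (has_sumZ (-1) f4))).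
congr has_sum; apply/funext => x /=; rewrite !mulN1r -!rmorphB /=.
have posB (r : R) : pos r - pos (- r) = r.
  by rewrite /pos; case: (leP r 0) => r0; case: (leP (- r) 0) => r1; lra.
by rewrite !posB -complexE.
Qed.

Lemma sum_has_sum f s : has_sum f s -> summability.sum (f : X -> R[i]^o) = s.
Proof.
move=> fs; have TF := @summability.totally_filter X.
apply: cvg_lim; first exact: norm_hausdorff.
apply/cvgrPdist_lt => e e0.
have [r r0 ->] : exists2 r, 0 < r & e = r%:C%C.
  by move: e0; case: e => a b; rewrite ltcE /= => /andP[/eqP -> a0]; exists a.
have [A fA] := fs _ r0; exists A => // B /= AB.
rewrite distrC /summability.partial_sum -(big_seq_fsetE _ _ xpredT f).
by rewrite ltcR; apply: fA.
Qed.
Lemma has_sum_uniform (J : Type) (r : seq J) (F : J -> X -> R[i]) (s : J -> R[i]) :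
  (forall j, has_sum (F j) (s j)) -> forall e : R, 0 < e ->
  exists A : {fset X}, forall B : {fset X}, (A `<=` B)%fset ->
    \sum_(j <- r) nrm (\sum_(x <- B) F j x - s j) < e.
Proof.
move=> Fs; elim: r => [|j r IH] e e0; first by exists fset0 => B _; rewrite big_nil.
have e2 : 0 < e / 2 by rewrite divr_gt0.
have [[A1 A1P] [A2 A2P]] := (Fs j _ e2, IH _ e2).
exists (A1 `|` A2)%fset => B; rewrite fsubUset => /andP[/A1P B1 /A2P B2].
by rewrite big_cons [e]splitr ltrD.
Qed.

(** One finite set approximates the sums [s j] for all [j] in [A] at once, so the bound passes to
    the limit. Both the norm of a convolution and the completeness of [ell1] rest on this. *)
Lemma has_sum_abs_bounded (J : choiceType) (F : J -> X -> R[i]) (s : J -> R[i]) M :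
  (forall j, has_sum (F j) (s j)) ->
  (forall (A : {fset J}) (B : {fset X}),
    \sum_(j <- A) nrm (\sum_(x <- B) F j x) <= M) ->
  forall A : {fset J}, \sum_(j <- A) nrm (s j) <= M.
Proof.
move=> Fs FM A; apply/ler_addgt0Pr => e e0.
have [B /(_ B (fsubset_refl _))/ltW BP] := has_sum_uniform A Fs e0.
apply: le_trans (lerD (FM A B) BP); rewrite -big_split /=; apply: ler_sum => j _.
rewrite -[X in _ + X]normcN opprB; set t := \sum_(_ <- _) _.
by rewrite -[s j in leLHS](subrK t) addrC le_normcD.
Qed.

End UnconditionalSums.

(** * The Banach algebra [ell1] and its centre *)

Section Ell1.
Variables (R : realType) (G : groupType).
Implicit Types (f g h : G -> R[i]) (M K : R) (x y z : G).

Definition class_function f := forall x y, f (x ^ y)%g = f x.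

Definition delta1 : G -> R[i] := fun x => (x == 1%g)%:R.

Let esum_le f M :
  (\esum_(x in setT) (nrm (f x))%:E <= M%:E)%E <-> abs_bounded f M.
Proof.
split=> [fM A|fM].
  rewrite -lee_fin; apply: le_trans fM; rewrite -sumEFin.
  rewrite (_ : \sum_(i <- A) (nrm (f i))%:E = \sum_(i \in [set` A]) (nrm (f i))%:E)%E.
    by apply: ereal_sup_ubound; exists [set` A] => //; split.
  by rewrite fsbig_finite //= set_fsetK.
apply: ge_ereal_sup => _ [A [finA _] <-].
by rewrite fsbig_finite //= sumEFin lee_fin; apply: fM.
Qed.

Let esum_norm_ge0 f : (0 <= \esum_(x in setT) (nrm (f x))%:E)%E.
Proof. by apply: esum_ge0 => x _; rewrite lee_fin normc_ge0. Qed.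

Let summable_esum f : ell1 f <-> (\esum_(x in setT) (nrm (f x))%:E < +oo)%E.
Proof.
rewrite /ell1 /= /summable (eq_esum (b := fun x => (nrm (f x))%:E)) //.
by move=> x _; rewrite /= ger0_norm ?normc_ge0.
Qed.

Lemma norm1_bounded f : ell1 f -> abs_bounded f (norm1 f).
Proof.
move=> /summable_esum fS; apply/esum_le; rewrite fineK //.
by rewrite ge0_fin_numE ?esum_norm_ge0.
Qed.

Lemma bounded_ell1 f M : abs_bounded f M -> ell1 f.
Proof. by move=> /esum_le fM; apply/summable_esum; rewrite (le_lt_trans fM) ?ltry. Qed.

Lemma norm1_le f M : abs_bounded f M -> norm1 f <= M.
Proof.
move=> fM; have := fM => /esum_le; rewrite -[norm1 f]/(fine _).
have := bounded_ell1 fM => /summable_esum fS; rewrite -lee_fin fineK //.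
by rewrite ge0_fin_numE ?esum_norm_ge0.
Qed.

Lemma norm1_ge0 f : 0 <= norm1 f.
Proof. exact: fine_ge0. Qed.

Lemma norm1_term f x : ell1 f -> nrm (f x) <= norm1 f.
Proof. by move/norm1_bounded/abs_bounded_term. Qed.

Lemma ell1D f g : ell1 f -> ell1 g -> ell1 (f \+ g).
Proof.
move=> /norm1_bounded fM /norm1_bounded gM.
exact: bounded_ell1 (abs_boundedD fM gM).
Qed.

Lemma ell1Z f a : ell1 f -> ell1 (a \*o f).
Proof. by move=> /norm1_bounded /(abs_boundedZ a) /bounded_ell1. Qed.

Lemma ell1B f g : ell1 f -> ell1 g -> ell1 (f \- g).
Proof.
move=> fl gl; have := ell1D fl (ell1Z (-1) gl); congr ell1.
by apply/funext => x /=; rewrite mulN1r.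
Qed.

Lemma norm1D f g : ell1 f -> ell1 g -> norm1 (f \+ g) <= norm1 f + norm1 g.
Proof.
move=> /norm1_bounded fM /norm1_bounded gM.
exact: norm1_le (abs_boundedD fM gM).
Qed.

Lemma norm1Z f a : ell1 f -> norm1 (a \*o f) <= nrm a * norm1 f.
Proof. by move=> /norm1_bounded /(abs_boundedZ a) /norm1_le. Qed.

Lemma norm1N f : norm1 (\- f) = norm1 f.
Proof. by congr fine; apply: eq_esum => x _; rewrite /= normcN. Qed.

Lemma norm1B f g : ell1 f -> ell1 g -> norm1 (f \- g) <= norm1 f + norm1 g.
Proof.
move=> fl gl; rewrite -(norm1N g); apply: norm1D => //.
have := ell1Z (-1) gl; congr ell1.
by apply/funext => x /=; rewrite mulN1r.
Qed.

Lemma ell1_fset f (A : {fset G}) : (forall x, x \notin A -> f x = 0) -> ell1 f.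
Proof. by move/abs_bounded_fset/bounded_ell1. Qed.

Lemma delta1_bounded : abs_bounded delta1 1.
Proof.
have := @abs_bounded_fset _ _ delta1 [fset 1%g]%fset.
rewrite big_seq_fset1 /delta1 eqxx ComplexField.Normc.normc1; apply=> x.
by rewrite !inE => /negPf ->.
Qed.

Lemma ell1_delta : ell1 delta1. Proof. exact: bounded_ell1 delta1_bounded. Qed.

Lemma norm1_delta : norm1 delta1 <= 1. Proof. exact: norm1_le delta1_bounded. Qed.

Lemma convol_bounded_term f g x : ell1 f -> ell1 g ->
  abs_bounded (fun y => f y * g (y^-1 * x)%g) (norm1 g * norm1 f).
Proof.
move=> fl gl A; apply: le_trans (_ : \sum_(y <- A) norm1 g * nrm (f y) <= _).
  apply: ler_sum => y _; rewrite ComplexField.Normc.normcM mulrC.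
  by rewrite ler_wpM2r ?normc_ge0 // norm1_term.
by rewrite -mulr_sumr ler_wpM2l ?norm1_ge0 //; apply: norm1_bounded.
Qed.

Lemma convol_has_sum f g x : ell1 f -> ell1 g ->
  has_sum (fun y => f y * g (y^-1 * x)%g) (convol f g x).
Proof.
move=> fl gl; have [s fs] := abs_bounded_has_sum (convol_bounded_term x fl gl).
by rewrite /convol (sum_has_sum fs).
Qed.

Lemma convol_eq f g x s :
  has_sum (fun y => f y * g (y^-1 * x)%g) s -> convol f g x = s.
Proof. by move=> fs; rewrite /convol (sum_has_sum fs). Qed.

Lemma convol_bounded f g : ell1 f -> ell1 g ->
  abs_bounded (convol f g) (norm1 f * norm1 g).
Proof.
move=> fl gl; apply: has_sum_abs_bounded => [x|A B].
  exact: convol_has_sum.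
apply: le_trans (_ : \sum_(x <- A) \sum_(y <- B) nrm (f y) * nrm (g (y^-1 * x)%g) <= _).
  apply: ler_sum => x _; apply: le_trans (normc_sum _ _ _) _.
  by apply: ler_sum => y _; rewrite ComplexField.Normc.normcM.
rewrite exchange_big /=.
apply: le_trans (_ : \sum_(y <- B) nrm (f y) * norm1 g <= _); last first.
  by rewrite -mulr_suml ler_wpM2r ?norm1_ge0 //; apply: norm1_bounded.
apply: ler_sum => y _; rewrite -mulr_sumr ler_wpM2l ?normc_ge0 //.
exact: (abs_bounded_comp (@mulgI _ y^-1)%g (norm1_bounded gl)).
Qed.

Lemma ell1_convol f g : ell1 f -> ell1 g -> ell1 (convol f g).
Proof. by move=> fl gl; apply: bounded_ell1 (convol_bounded fl gl). Qed.

Lemma norm1_convol f g : ell1 f -> ell1 g -> norm1 (convol f g) <= norm1 f * norm1 g.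
Proof. by move=> fl gl; apply: norm1_le (convol_bounded fl gl). Qed.

Lemma convolDr f g h : ell1 f -> ell1 g -> ell1 h ->
  convol f (g \+ h) = convol f g \+ convol f h.
Proof.
move=> fl gl hl; apply/funext => x; apply: convol_eq.
have := has_sumD (convol_has_sum x fl gl) (convol_has_sum x fl hl).
by congr has_sum; apply/funext => y /=; rewrite mulrDr.
Qed.

Lemma convolZr f g a : ell1 f -> ell1 g -> convol f (a \*o g) = a \*o convol f g.
Proof.
move=> fl gl; apply/funext => x; apply: convol_eq.
have := has_sumZ a (convol_has_sum x fl gl).
by congr has_sum; apply/funext => y /=; rewrite mulrCA.
Qed.

Lemma convolBr f g h : ell1 f -> ell1 g -> ell1 h ->
  convol f (g \- h) = convol f g \- convol f h.
Proof.
move=> fl gl hl; have -> : g \- h = g \+ (-1) \*o h.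
  by apply/funext => x /=; rewrite mulN1r.
rewrite convolDr ?convolZr //; last exact: ell1Z.
by apply/funext => x /=; rewrite mulN1r.
Qed.

Lemma convolDl f g h : ell1 f -> ell1 g -> ell1 h ->
  convol (f \+ g) h = convol f h \+ convol g h.
Proof.
move=> fl gl hl; apply/funext => x; apply: convol_eq.
have := has_sumD (convol_has_sum x fl hl) (convol_has_sum x gl hl).
by congr has_sum; apply/funext => y /=; rewrite mulrDl.
Qed.

Lemma convolZl f g a : ell1 f -> ell1 g -> convol (a \*o f) g = a \*o convol f g.
Proof.
move=> fl gl; apply/funext => x; apply: convol_eq.
have := has_sumZ a (convol_has_sum x fl gl).
by congr has_sum; apply/funext => y /=; rewrite mulrA.
Qed.

Lemma convolBl f g h : ell1 f -> ell1 g -> ell1 h ->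
  convol (f \- g) h = convol f h \- convol g h.
Proof.
move=> fl gl hl; have -> : f \- g = f \+ (-1) \*o g.
  by apply/funext => x /=; rewrite mulN1r.
rewrite convolDl ?convolZl //; last exact: ell1Z.
by apply/funext => x /=; rewrite mulN1r.
Qed.

Lemma convol_finite f g (A : {fset G}) x : (forall y, y \notin A -> f y = 0) ->
  convol f g x = \sum_(y <- A) f y * g (y^-1 * x)%g.
Proof.
by move=> fA; apply: convol_eq; apply: has_sum_fset => y /fA ->; rewrite mul0r.
Qed.

Lemma convol_delta f : convol delta1 f = f.
Proof.
apply/funext => x; rewrite (@convol_finite _ _ [fset 1%g]%fset) => [|y].
  by rewrite big_seq_fset1 /delta1 eqxx mul1r invg1 mul1g.
by rewrite !inE /delta1 => /negPf ->.
Qed.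

Lemma convol_translate z f x :
  convol (fun y => delta1 (z^-1 * y)%g) f x = f (z^-1 * x)%g.
Proof.
rewrite (@convol_finite _ _ [fset z]%fset) => [|y].
  by rewrite big_seq_fset1 /delta1 mulVg eqxx mul1r.
by rewrite !inE /delta1 mulg_eq1 eqg_inv eq_sym => /negPf ->.
Qed.

Lemma convol_translate_r z f x :
  convol f (fun y => delta1 (z^-1 * y)%g) x = f (x * z^-1)%g.
Proof.
apply: convol_eq.
have := @has_sum_fset _ _ (fun y => f y * delta1 (z^-1 * (y^-1 * x))%g)
  [fset (x * z^-1)%g]%fset.
rewrite big_seq_fset1 /delta1 invgM invgK mulgVK mulVg eqxx mulr1; apply=> y.
rewrite mulg_eq1 eqg_inv; have [->|_ _] := eqVneq z; last by rewrite mulr0.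
by rewrite !inE invgM invgK mulVKg eqxx.
Qed.

(** Substituting [y^-1 * x] for the summation variable turns the argument of [f] into the conjugate
    [y ^ x]. *)
Lemma class_convolC f g : ell1 f -> ell1 g -> class_function f ->
  convol f g = convol g f.
Proof.
move=> fl gl fJ; apply/funext => x; apply: convol_eq.
have hK : cancel (fun y => x * y^-1)%g (fun y => y^-1 * x)%g.
  by move=> y; rewrite invgM invgK mulgVK.
have kK : cancel (fun y => y^-1 * x)%g (fun y => x * y^-1)%g.
  by move=> y; rewrite invgM invgK mulVKg.
have := has_sum_comp kK hK (convol_has_sum x gl fl).
congr has_sum; apply/funext => y /=.
by rewrite mulrC invgM invgK -mulgA -conjgE fJ.
Qed.

(** Commuting with point masses, which act as translations on either side, forces invariance under
    conjugation. *)
Lemma Zell1P f : Zell1 f <-> ell1 f /\ class_function f.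
Proof.
split=> [[fl fC]|[fl fJ]]; last by split=> // g gl; apply: class_convolC.
split=> // x y; rewrite conjgE.
have dl : ell1 (fun z => delta1 (y^-1 * z)%g).
  by apply: bounded_ell1 (abs_bounded_comp (@mulgI _ y^-1%g) (norm1_bounded ell1_delta)).
by rewrite -convol_translate -fC // convol_translate_r mulgK.
Qed.

Lemma class_convol f g : ell1 f -> ell1 g ->
  class_function f -> class_function g -> class_function (convol f g).
Proof.
move=> fl gl fJ gJ x y; apply: convol_eq.
have := has_sum_comp (conjgKV y) (conjgK y) (convol_has_sum x fl gl).
congr has_sum; apply/funext => z /=; rewrite fJ; congr (_ * _).
by rewrite -[LHS](gJ _ y) conjMg conjVg conjgKV.
Qed.

Lemma Zell1_delta : Zell1 delta1.
Proof. by apply/Zell1P; split=> [|x y]; [exact: ell1_delta | rewrite /delta1 conjg_eq1]. Qed.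

Lemma Zell1_ell1 f : Zell1 f -> ell1 f. Proof. by case. Qed.

Lemma Zell1_class f : Zell1 f -> class_function f. Proof. by move/Zell1P=> []. Qed.

Lemma Zell1D f g : Zell1 f -> Zell1 g -> Zell1 (f \+ g).
Proof.
move=> /Zell1P[fl fJ] /Zell1P[gl gJ]; apply/Zell1P; split; first exact: ell1D.
by move=> x y /=; rewrite fJ gJ.
Qed.

Lemma Zell1Z f a : Zell1 f -> Zell1 (a \*o f).
Proof.
move=> /Zell1P[fl fJ]; apply/Zell1P; split; first exact: ell1Z.
by move=> x y /=; rewrite fJ.
Qed.

Lemma Zell1B f g : Zell1 f -> Zell1 g -> Zell1 (f \- g).
Proof.
move=> /Zell1P[fl fJ] /Zell1P[gl gJ]; apply/Zell1P; split; first exact: ell1B.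
by move=> x y /=; rewrite fJ gJ.
Qed.

Lemma Zell1_convol f g : Zell1 f -> Zell1 g -> Zell1 (convol f g).
Proof.
move=> /Zell1P[fl fJ] /Zell1P[gl gJ]; apply/Zell1P.
by split; [exact: ell1_convol | exact: class_convol].
Qed.

End Ell1.

(** * Algebra characters are contractive *)

Section CharacterBound.
Variables (R : realType) (G : groupType).
Implicit Types (f g h : G -> R[i]) (w : (G -> R[i]) -> R[i]).

(** Completeness of [ell1] in the form used: [h] is the pointwise sum, and [K N] bounds the tail of
    the norms from index [N] on. *)
Lemma absolutely_convergent_series (X : choiceType) (u : nat -> X -> R[i])
    (c K : nat -> R) :
  (forall n, abs_bounded (u n) (c n)) ->
  (forall N (A : {fset nat}), \sum_(n <- A | (N <= n)%N) c n <= K N) ->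
  exists h : X -> R[i],
    forall N, abs_bounded (fun x => h x - \sum_(n < N) u n x) (K N).
Proof.
move=> uc cK; have ex x : exists s, has_sum (u^~ x) s.
  apply: (@abs_bounded_has_sum _ _ _ (K 0%N)) => A; apply: le_trans (cK 0%N A).
  by apply: ler_sum => n _; apply: abs_bounded_term (uc n).
have [h hP] := boolp.choice ex; exists h => N.
apply: (has_sum_abs_bounded (F := fun x n => if (N <= n)%N then u n x else 0)).
  move=> x; pose v n := if (n < N)%N then u n x else 0.
  have vS : has_sum v (\sum_(n < N) u n x).
    have := @has_sum_fset _ _ v [fset n in iota 0 N]%fset.
    rewrite (perm_big (iota 0 N)) /=; last first.
      apply: uniq_perm => [||n]; rewrite ?fset_uniq ?iota_uniq //.
      by rewrite !inE.
    have -> : \sum_(i <- iota 0 N) v i = \sum_(n < N) u n x.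
      rewrite -[X in iota _ X]subn0 -/(index_iota 0 N) big_mkord.
      by apply: eq_bigr => n _; rewrite /v ltn_ord.
    by apply=> n; rewrite !inE mem_iota /v add0n /= => /negPf ->.
  have := has_sumD (hP x) (has_sumZ (-1) vS); rewrite mulN1r.
  congr has_sum; apply/funext => n /=; rewrite /v mulN1r.
  by case: (ltnP n N) => _; rewrite ?subrr ?subr0.
move=> A B; apply: le_trans (cK N B).
apply: le_trans (_ : \sum_(n <- B | (N <= n)%N) \sum_(x <- A) nrm (u n x) <= _).
  rewrite exchange_big; apply: ler_sum => x _.
  by rewrite -big_mkcond /=; apply: normc_sum.
by apply: ler_sum => n _; apply: uc.
Qed.

Lemma geometric_tail (r : R) N (A : {fset nat}) : 0 <= r -> r < 1 ->
  \sum_(n <- A | (N <= n)%N) r ^+ n.+1 <= r ^+ N.+1 / (1 - r).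
Proof.
move=> r0 r1; have r1' : 0 < 1 - r by rewrite subr_gt0.
pose M := maxn N (\max_(n <- A) n).+1.
have AM : perm_eq [seq n <- iota 0 M | n \in A] A.
  apply: uniq_perm => [||n]; rewrite ?fset_uniq ?filter_uniq ?iota_uniq //.
  rewrite mem_filter mem_iota /= add0n; case: (boolP (n \in A)) => //= nA.
  by rewrite /M leq_max ltnS leq_bigmax_seq ?orbT.
rewrite -(perm_big _ AM) /= big_filter_cond.
apply: le_trans (_ : \sum_(N <= n < M) r ^+ n.+1 <= _).
  rewrite /index_iota -[M in iota 0 M](subnKC (leq_maxl N _)) iotaD add0n big_cat /=.
  rewrite big_seq_cond big_pred0 ?add0r => [|n]; last first.
    by rewrite mem_iota add0n /=; case: leqP; rewrite ?andbF.
  rewrite big_mkcond; apply: ler_sum => n _; case: ifP => // _.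
  by rewrite exprn_ge0.
rewrite ler_pdivlMr // mulr_suml.
rewrite (eq_bigr (fun n => - (r ^+ n.+2 - r ^+ n.+1))) => [|n _]; last first.
  by rewrite mulrBr mulr1 -exprSr opprB.
rewrite sumrN (telescope_sumr (fun n => r ^+ n.+1)) ?leq_maxl //.
by rewrite opprB gerBl exprn_ge0.
Qed.

(** The index is shifted: this is the power of exponent [n.+1]. *)
Fixpoint convol_power f n : G -> R[i] :=
  if n is n'.+1 then convol f (convol_power f n') else f.

Lemma Zell1_convol_power f n : Zell1 f -> Zell1 (convol_power f n).
Proof. by move=> fZ; elim: n => //= n; apply: Zell1_convol. Qed.

Lemma convol_power_bounded f n :
  Zell1 f -> abs_bounded (convol_power f n) (norm1 f ^+ n.+1).
Proof.
move=> fZ; have fl := Zell1_ell1 fZ; elim: n => [|n IH] /=.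
  by rewrite expr1; apply: norm1_bounded.
apply: abs_bounded_le (convol_bounded fl (bounded_ell1 IH)).
by rewrite exprS ler_wpM2l ?norm1_ge0 // norm1_le.
Qed.

(* [h] is the sum of the Neumann series of [f]. *)
Lemma quasi_inverse f : Zell1 f -> norm1 f < 1 ->
  exists2 h, Zell1 h & h = f \+ convol f h.
Proof.
move=> fZ f1; have fl := Zell1_ell1 fZ.
have [h hP] := absolutely_convergent_series
  (fun n => convol_power_bounded n fZ)
  (fun N A => geometric_tail N A (norm1_ge0 f) f1).
pose p N : G -> R[i] := fun x => \sum_(n < N) convol_power f n x.
have pS N : p N.+1 = p N \+ convol_power f N.
  by apply/funext => x; rewrite /p big_ord_recr.
have p0 : p 0%N = fun=> 0 by apply/funext => x; rewrite /p big_ord0.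
have Z0 : Zell1 (fun _ : G => 0 : R[i]).
  have := Zell1Z 0 fZ; congr Zell1; apply/funext => x /=; exact: mul0r.
have pZ N : Zell1 (p N).
  by elim: N => [|N IH]; rewrite ?p0 // pS; apply: Zell1D => //; apply: Zell1_convol_power.
have tl N : abs_bounded (h \- p N) (norm1 f ^+ N.+1 / (1 - norm1 f)) := hP N.
(* The partial sums satisfy the equation of [h] up to a shift of [N], which disappears in the
   limit. *)
have pE N : p N.+1 = f \+ convol f (p N).
  elim: N => [|N IH].
    have -> : convol f (p 0%N) = fun=> 0.
      rewrite p0; apply/funext => x; apply: convol_eq.
      have := @has_sum_fset _ _ (fun y : G => f y * 0) fset0.
      by rewrite big_seq_fset0; apply=> y _; rewrite mulr0.
    by rewrite pS p0; apply/funext => x /=; rewrite add0r addr0.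
  have pl : ell1 (p N) := Zell1_ell1 (pZ N).
  have ul : ell1 (convol_power f N) := Zell1_ell1 (Zell1_convol_power N fZ).
  rewrite [LHS]pS {1}IH pS convolDr //.
  by apply/funext => x /=; rewrite addrA.
pose b N := norm1 f ^+ N.+1 / (1 - norm1 f).
have b_small (e : R) : 0 < e -> exists N, b N < e.
  move=> e0; have f1' : 0 < 1 - norm1 f by rewrite subr_gt0.
  have := @cvg_expr R (norm1 f); rewrite ger0_norm ?norm1_ge0 // => /(_ f1).
  move=> /cvgrPdist_lt/(_ _ (mulr_gt0 e0 f1')) [N _ /(_ N.+1 (leqnSn N))].
  rewrite sub0r normrN ger0_norm ?exprn_ge0 ?norm1_ge0 // => bN.
  by exists N; rewrite /b ltr_pdivrMr.
(* Both identities below replace [h] by a partial sum in two places, each at a cost of at most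
   [b N]. *)
have eq_small (z : R[i]) : (forall N, nrm z <= b N + b N) -> z = 0.
  move=> zb; apply/eqP; rewrite -normc_eq0 eq_le normc_ge0 andbT.
  apply/ler_addgt0Pr => e e0; rewrite add0r.
  have [N bN] := b_small _ (divr_gt0 e0 (ltr0n _ 2)).
  by apply: le_trans (zb N) _; rewrite [e]splitr ltW // ltrD.
have tl_x N x : nrm (h x - p N x) <= b N by apply: abs_bounded_term (hP N).
have hJ : class_function h.
  move=> x y; apply/eqP; rewrite -subr_eq0; apply/eqP/eq_small => N.
  have -> : h (x ^ y)%g - h x = (h (x ^ y)%g - p N (x ^ y)%g) - (h x - p N x).
    by rewrite (Zell1_class (pZ N)) opprB addrA subrK.
  by apply: le_trans (le_normcD _ _) _; rewrite normcN lerD.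
have hl : ell1 h.
  have := ell1D (bounded_ell1 (tl 0%N)) (Zell1_ell1 (pZ 0%N)).
  by congr ell1; apply/funext => x /=; rewrite subrK.
have pl N : ell1 (p N) := Zell1_ell1 (pZ N).
exists h; first exact/Zell1P.
apply/funext => x; apply/eqP; rewrite -subr_eq0; apply/eqP/eq_small => N.
have -> : h x - (f \+ convol f h) x = (h x - p N.+1 x) - convol f (h \- p N) x.
  by rewrite pE convolBr //=; ring.
apply: le_trans (le_normcD _ _) _; rewrite normcN; apply: lerD.
  apply: le_trans (tl_x N.+1 x) _; rewrite /b exprS -mulrA.
  apply: ler_piMl (ltW f1); apply: divr_ge0; first by rewrite exprn_ge0 ?norm1_ge0.
  by rewrite subr_ge0 ltW.
apply: le_trans (norm1_term _ _) _; first exact/ell1_convol/ell1B.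
apply: le_trans (norm1_convol _ _) _; rewrite ?ell1B //; first exact: ell1B.
apply: le_trans (_ : 1 * norm1 (h \- p N) <= _).
  by rewrite ler_wpM2r ?norm1_ge0 // ltW.
by rewrite mul1r norm1_le.
Qed.

Lemma Zell1_0 : Zell1 (fun _ : G => 0 : R[i]).
Proof.
have := Zell1B (Zell1_delta R G) (Zell1_delta R G).
by congr Zell1; apply/funext => x /=; rewrite subrr.
Qed.

Section Character.
Variable w : (G -> R[i]) -> R[i].
Hypothesis wchar : algebra_character w.

Lemma characterB f g : Zell1 f -> Zell1 g -> w (f \- g) = w f - w g.
Proof.
have [wlin _ _] := wchar; move=> fZ gZ.
rewrite addrC -mulN1r -wlin //; congr w; apply/funext => x /=.
by rewrite mulN1r addrC.
Qed.

Lemma character0 : w (fun=> 0) = 0.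
Proof.
transitivity (w ((fun=> 0) \- (fun=> 0))).
  by congr w; apply/funext => x /=; rewrite subrr.
by rewrite characterB ?subrr //; exact: Zell1_0.
Qed.

Lemma characterZ a f : Zell1 f -> w (a \*o f) = a * w f.
Proof.
have [wlin _ _] := wchar; move=> fZ.
rewrite -[RHS]addr0 -character0 -wlin //; last exact: Zell1_0.
by congr w; apply/funext => x /=; rewrite addr0.
Qed.

Lemma character_delta : w (@delta1 R G) = 1.
Proof.
have [_ wmul [f fZ f0]] := wchar; apply: (mulIf f0); rewrite mul1r -wmul //.
  by rewrite convol_delta.
exact: Zell1_delta.
Qed.

(** Otherwise [g = f / w f] has norm less than 1 and [w g = 1], and applying [w] to
    [h = g \+ convol g h] yields [w h = 1 + w h]. *)
Lemma character_bound f : Zell1 f -> nrm (w f) <= norm1 f.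
Proof.
have [wlin wmul _] := wchar; move=> fZ; rewrite leNgt; apply/negP => fw.
have wf_gt0 : 0 < nrm (w f) := le_lt_trans (norm1_ge0 f) fw.
have wf0 : w f != 0 by rewrite -normc_eq0 gt_eqF.
pose g := (w f)^-1 \*o f; have gZ : Zell1 g by apply: Zell1Z.
have g1 : norm1 g < 1.
  apply: le_lt_trans (norm1Z _ (Zell1_ell1 fZ)) _.
  by rewrite ComplexField.Normc.normcV mulrC ltr_pdivrMr ?mul1r.
have [h hZ hE] := quasi_inverse gZ g1.
have : w h = w g + w g * w h.
  rewrite -wmul // -[w g]mul1r -wlin //; last exact: Zell1_convol.
  by congr w; rewrite {1}hE; apply/funext => x /=; rewrite mul1r.
rewrite characterZ // mulVf // mul1r => /eqP.
by rewrite eq_sym -subr_eq0 addrK oner_eq0.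
Qed.

End Character.

End CharacterBound.

(** * Restricted direct products *)

Section Coordinates.
Variables (R : realType) (I : Type) (G : I -> finGroupType).
Local Notation T := {classic I}.
Local Notation C := R[i].
Implicit Types (i j : T) (x y : restr_prod G) (F E : {fset T}).

Local Notation inc i := (@coord_incl I G i).

Lemma rp_mulE x y (i : I) : (x * y)%g i = (x i * y i)%g. Proof. by []. Qed.
Lemma rp_invE x (i : I) : (x^-1)%g i = (x i)^-1%g. Proof. by []. Qed.

Lemma coord_incl_in (i : T) (g : G i) : inc i g i = g.
Proof. exact: (@dfwith_in T G (fun=> 1%g)). Qed.

Lemma coord_incl_out (i j : T) (g : G i) : j != i -> inc i g j = 1%g.
Proof. by rewrite eq_sym => ij; apply: (@dfwith_out T G (fun=> 1%g)). Qed.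

Lemma coord_inclP x i : inc i (x i) = x <-> forall j, j != i -> x j = 1%g.
Proof.
split=> [<- j ji|x1]; first exact: coord_incl_out.
apply: rp_ext => j; have [->|ji] := eqVneq (j : T) i; first exact: coord_incl_in.
by rewrite coord_incl_out // x1.
Qed.

Lemma coord_inclV i (a : G i) : inc i a^-1%g = (inc i a)^-1%g.
Proof.
apply: rp_ext => j; rewrite rp_invE; have [->|ji] := eqVneq (j : T) i.
  by rewrite !coord_incl_in.
by rewrite !coord_incl_out // invg1.
Qed.

Lemma coord_incl_commute i (a : G i) x : x i = 1%g -> (inc i a * x = x * inc i a)%g.
Proof.
move=> x1; apply: rp_ext => j; rewrite !rp_mulE; have [->|ji] := eqVneq (j : T) i.
  by rewrite x1 mulg1 mul1g.
by rewrite !coord_incl_out // mulg1 mul1g.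
Qed.

Lemma coord_incl_inj i : injective (inc i).
Proof. by move=> a b /(congr1 (fun x : restr_prod G => x i)); rewrite !coord_incl_in. Qed.

(** Resets coordinate [i] to 1. Inductions on a finite set of indices remove one coordinate at a
    time with it. *)
Definition strip i x : restr_prod G := ((inc i (x i))^-1 * x)%g.

Lemma strip_in i x : strip i x i = 1%g.
Proof. by rewrite /strip rp_mulE rp_invE coord_incl_in mulVg. Qed.

Lemma strip_out i j x : j != i -> strip i x j = x j.
Proof. by move=> ji; rewrite /strip rp_mulE rp_invE coord_incl_out // invg1 mul1g. Qed.

Lemma stripK i x : (inc i (x i) * strip i x)%g = x.
Proof. by rewrite /strip mulVKg. Qed.

Definition supported F x : bool := `[< forall i, i \notin F -> x i = 1%g >].

Lemma supportedP F x : reflect (forall i, i \notin F -> x i = 1%g) (supported F x).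
Proof. exact: asboolP. Qed.

Lemma supported_conj F x y : supported F (x ^ y)%g = supported F x.
Proof.
apply/supportedP/supportedP => xF i /xF; last by rewrite !rp_mulE => ->; rewrite mul1g mulVg.
by rewrite !rp_mulE -conjgE => /eqP; rewrite conjg_eq1 => /eqP.
Qed.

Lemma supportedM F x y : supported F x -> supported F y -> supported F (x * y)%g.
Proof.
move=> /supportedP xF /supportedP yF; apply/supportedP => i iF.
by rewrite rp_mulE xF // yF // mulg1.
Qed.

Lemma supported0 x : supported fset0 x = (x == 1%g).
Proof.
apply/supportedP/eqP => [x1|-> //]; apply: rp_ext => i; exact: x1.
Qed.

Lemma supportedU1 i F x : supported (i |` F)%fset x = supported F (strip i x).
Proof.
apply/supportedP/supportedP => xF j jF; have [ji|ji] := eqVneq j i.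
- by rewrite ji strip_in.
- by rewrite strip_out // xF // !inE negb_or ji.
- by move: jF; rewrite ji !inE eqxx.
by rewrite -(strip_out x ji) xF //; move: jF; rewrite !inE negb_or => /andP[].
Qed.

Lemma supported_sub F E x : (F `<=` E)%fset -> supported F x -> supported E x.
Proof.
move=> FE /supportedP xF; apply/supportedP => i iE; apply: xF.
by apply: contra iE; apply: (fsubsetP FE).
Qed.

Lemma supported_ex x : exists F, supported F x.
Proof.
exists (fset_set ([set i : T | x i != 1%g] : set T)); apply/supportedP => i.
rewrite in_fset_set; last exact: (rp_fin x).
by rewrite notin_setE /= => /negP; rewrite negbK => /eqP.
Qed.

Definition restrict F (f : restr_prod G -> C) : restr_prod G -> C :=
  fun x => if supported F x then f x else 0.

Lemma Zell1_restrict F f : Zell1 f -> Zell1 (restrict F f).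
Proof.
move=> /Zell1P[fl fJ]; apply/Zell1P; split.
  apply: bounded_ell1 (abs_bounded_dom _ (norm1_bounded fl)) => x.
  by rewrite /restrict; case: ifP => // _; rewrite ComplexField.Normc.normc0 normc_ge0.
by move=> x y; rewrite /restrict supported_conj fJ.
Qed.

(** A finite set of points carries all of the norm but [e]; as soon as [E] contains their nontrivial
    coordinates, restriction changes nothing at these points. *)
Lemma restrict_approx f (e : R) : ell1 f -> 0 < e ->
  exists F, forall E, (F `<=` E)%fset -> norm1 (f \- restrict E f) <= e.
Proof.
move=> fl e0.
have [A fA] : exists A : {fset restr_prod G}, norm1 f - e < \sum_(x <- A) nrm (f x).
  apply/not_existsP => nA; suff : norm1 f <= norm1 f - e by lra.
  by apply: norm1_le => A; rewrite leNgt; apply/negP/nA.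
have [s sP] := boolp.choice supported_ex.
exists (\bigcup_(x <- A) s x)%fset => E sE; apply: norm1_le => B.
have AE x : x \in A -> supported E x.
  move=> xA; apply: supported_sub (sP x); apply: fsubset_trans sE.
  exact: bigfcup_sup.
have := norm1_bounded fl (A `|` B)%fset; rewrite (big_fsetID _ (mem A)) /=.
rewrite (_ : [fset x | x in (A `|` B)%fset & x \in A]%fset = A); last first.
  by apply/fsetP => x; rewrite !inE; case: (x \in A); rewrite ?andbF.
have : \sum_(x <- B) nrm ((f \- restrict E f) x) <=
    \sum_(x <- [fset x | x in (A `|` B)%fset & x \notin A]%fset) nrm (f x).
  rewrite (big_fsetID _ (mem A)) /= big1_fset ?add0r => [|x].
    rewrite (_ : [fset x | x in (A `|` B)%fset & x \notin A]%fset =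
      [fset x | x in B & x \notin A]%fset).
      apply: ler_sum => x _; rewrite /restrict; case: ifP => _; rewrite ?subr0 //.
      by rewrite subrr ComplexField.Normc.normc0 normc_ge0.
    by apply/fsetP => x; rewrite !inE; case: (x \in A); rewrite ?andbF.
  rewrite !inE => /andP[_ /AE xE] _.
  by rewrite /restrict xE subrr ComplexField.Normc.normc0.
move: fA; lra.
Qed.

Lemma ext_zero_incl i (u : G i -> C) (a : G i) : ext_zero u (inc i a) = u a.
Proof. by rewrite /ext_zero mem_set ?coord_incl_in //; exists a. Qed.

Lemma ext_zero_out i (u : G i -> C) x : (forall a, x <> inc i a) -> ext_zero u x = 0.
Proof.
by move=> xi; rewrite /ext_zero memNset // => -[a _ E]; apply: (xi a).
Qed.

Definition incl_fset i : {fset restr_prod G} := [fset inc i a | a in G i]%fset.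

Lemma ext_zero_fset i (u : G i -> C) x : x \notin incl_fset i -> ext_zero u x = 0.
Proof.
move=> xi; apply: ext_zero_out => a E; move/negP: xi; apply.
by rewrite E; apply/imfsetP; exists a.
Qed.

Lemma ell1_ext_zero i (u : G i -> C) : ell1 (ext_zero u).
Proof. exact: ell1_fset (@ext_zero_fset i u). Qed.

Lemma norm1_ext_zero i (u : G i -> C) : norm1 (ext_zero u) <= \sum_(a : G i) nrm (u a).
Proof.
apply: le_trans (norm1_le (abs_bounded_fset (@ext_zero_fset i u))) _.
rewrite big_imfset /=; last by move=> a b _ _; apply: coord_incl_inj.
by rewrite big_enum; apply: ler_sum => a _; rewrite ext_zero_incl.
Qed.

Lemma convol_ext_zero i (u : G i -> C) f x :
  convol (ext_zero u) f x = \sum_(a : G i) u a * f ((inc i a)^-1 * x)%g.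
Proof.
rewrite (convol_finite _ _ (@ext_zero_fset i u)) big_imfset /=; last first.
  by move=> a b _ _; apply: coord_incl_inj.
by rewrite big_enum; apply: eq_bigr => a _; rewrite ext_zero_incl.
Qed.

Lemma class_ext_zero i (u : G i -> C) :
  (forall a b, u (a ^ b)%g = u a) -> class_function (ext_zero u).
Proof.
move=> uJ x y; have [xi|xi] := pselect (inc i (x i) = x).
  rewrite -[in RHS]xi ext_zero_incl -[RHS](uJ _ (y i)) -ext_zero_incl.
  congr ext_zero; apply: rp_ext => j; have [->|ji] := eqVneq (j : T) i.
    by rewrite coord_incl_in.
  rewrite coord_incl_out // conjgE !rp_mulE rp_invE.
  by have /coord_inclP/(_ _ ji) -> := xi; rewrite mul1g mulVg.
rewrite !ext_zero_out // => a E; apply: xi; first by rewrite E coord_incl_in.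
apply/coord_inclP => j ji; apply: (can_inj (conjgK (y j))); rewrite conj1g.
by rewrite -[RHS](coord_incl_out a ji) -E.
Qed.

(** A function carried by one finite factor acts as a finite combination of left translations, and
    these commute with convolution on the right. *)
Lemma convol_ext_zeroA i (u : G i -> C) f g : ell1 f -> ell1 g ->
  convol (convol (ext_zero u) f) g = convol (ext_zero u) (convol f g).
Proof.
move=> fl gl; apply/funext => x; apply: convol_eq.
rewrite convol_ext_zero.
have transl (a : G i) : has_sum
    (fun y => u a * (f ((inc i a)^-1 * y)%g * g (y^-1 * x)%g))
    (u a * convol f g ((inc i a)^-1 * x)%g).
  have := has_sumZ (u a) (has_sum_comp (mulKg (inc i a)^-1)%g
    (mulVKg (inc i a)^-1)%g (convol_has_sum ((inc i a)^-1 * x)%g fl gl)).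
  by congr has_sum; apply/funext => y /=; rewrite invgM invgK -mulgA mulVKg.
rewrite (_ : (fun y => _) = (fun y => \sum_(a : G i)
    u a * (f ((inc i a)^-1 * y)%g * g (y^-1 * x)%g))); last first.
  apply/funext => y; rewrite convol_ext_zero mulr_suml.
  by apply: eq_bigr => a _; rewrite mulrA.
elim: (index_enum (G i)) => [|a r IH].
  rewrite big_nil; have := @has_sum_fset _ _ (fun _ : restr_prod G => 0 : C) fset0.
  rewrite big_seq_fset0 => /(_ (fun _ _ => erefl)).
  by congr has_sum; apply/funext => y; rewrite big_nil.
rewrite big_cons; have := has_sumD (transl a) IH.
by congr has_sum; apply/funext => y; rewrite big_cons.
Qed.

End Coordinates.

(** * Products of minimal central idempotents *)

Section ProductIdempotents.
Variables (R : realType) (I : Type) (G : I -> finGroupType).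
Local Notation T := {classic I}.
Local Notation C := R[i].
Variable psi : forall i : I, G i -> C.
Hypothesis psiS : forall i, spherical (@psi i).
Implicit Types (i j : T) (x y : restr_prod G) (F E : {fset T}).
Implicit Types (f g : restr_prod G -> C).

Local Notation inc i := (@coord_incl I G i).

Definition mass i : R := \sum_(a : G i) nrm (psi a) ^+ 2.
(** For [psi = chi / d] the mass is [|G i| / d^2], and this is the minimal central idempotent
    [d chi / |G i|]. *)
Definition unit_idem i : G i -> C := fun a => psi a / (mass i)%:C%C.
Definition idem_norm i : R := \sum_(a : G i) nrm (unit_idem a).

Definition prod_idem F : restr_prod G -> C := fun x =>
  if supported F x then \prod_(i <- F) unit_idem (x i) else 0.

Lemma mass_gt0 i : 0 < mass i. Proof. exact: spherical_mass_gt0. Qed.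

Lemma mass_neq0 i : (mass i)%:C%C != 0 :> C.
Proof. by rewrite eq_complex /= eqxx andbT gt_eqF ?mass_gt0. Qed.

Lemma unit_idem_class i (a b : G i) : unit_idem (a ^ b)%g = unit_idem a.
Proof. by rewrite /unit_idem spherical_class. Qed.

Lemma unit_idem1_neq0 i : unit_idem (1%g : G i) != 0.
Proof. by rewrite /unit_idem (psiS i).1 mul1r invr_eq0 mass_neq0. Qed.

Lemma unit_idem_psi i (a : G i) : unit_idem a = psi a * unit_idem (1%g : G i).
Proof. by rewrite /unit_idem (psiS i).1 mul1r. Qed.

Lemma idem_normE i : idem_norm i = (\sum_(a : G i) nrm (psi a)) / mass i.
Proof.
rewrite /idem_norm mulr_suml; apply: eq_bigr => a _.
rewrite ComplexField.Normc.normcM ComplexField.Normc.normcV normc_real //.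
exact: ltW (mass_gt0 i).
Qed.

Lemma idem_norm_ge1 i : 1 <= idem_norm i.
Proof.
rewrite idem_normE ler_pdivlMr ?mass_gt0 // mul1r; apply: ler_sum => a _.
rewrite expr2 ler_piMl ?normc_ge0 //; exact: spherical_norm_le1.
Qed.

Lemma prod_idem_norm_ge1 (r : seq T) (P : pred T) : 1 <= \prod_(i <- r | P i) idem_norm i.
Proof.
elim/big_ind: _ => // [u v u1 v1|i _]; last exact: idem_norm_ge1.
by rewrite -[1]mulr1 ler_pM.
Qed.

Lemma idem_norm_gap i : idem_norm i != 1 -> 1 + 1 / 1000 <= idem_norm i.
Proof.
apply: contraR; rewrite -ltNge idem_normE ltr_pdivrMr ?mass_gt0 // => /ltW small.
have -> : \sum_(a : G i) nrm (psi a) = mass i := spherical_gap (psiS i) small.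
by rewrite divff // gt_eqF ?mass_gt0.
Qed.

Lemma prod_idem0 : prod_idem fset0 = @delta1 R (restr_prod G).
Proof.
apply/funext => x; rewrite /prod_idem /delta1 supported0 big_seq_fset0.
by case: eqP.
Qed.

(** Only the term [a = x i] survives: any other [a] leaves a nontrivial coordinate at [i], outside
    [F]. *)
Lemma prod_idemU1 i F : i \notin F ->
  prod_idem (i |` F)%fset = convol (ext_zero (@unit_idem i)) (prod_idem F).
Proof.
move=> iF; apply/funext => x; rewrite convol_ext_zero.
have off a : a != x i -> prod_idem F ((inc i a)^-1 * x)%g = 0.
  move=> ax; rewrite /prod_idem; case: supportedP => // /(_ i iF).
  rewrite rp_mulE rp_invE coord_incl_in => /eqP; rewrite mulg_eq1 eqg_inv => E.
  by rewrite E in ax.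
rewrite (bigD1 (x i)) //= big1 ?addr0 => [|a /off ->]; last by rewrite mulr0.
rewrite -/(strip i x) /prod_idem supportedU1; case: ifP => _; last by rewrite mulr0.
rewrite big_fsetU1 //; congr (_ * _); rewrite big_seq [RHS]big_seq.
apply: eq_bigr => j jF; rewrite strip_out //.
by apply: contraNneq iF => <-.
Qed.

Lemma Zell1_unit_idem i : Zell1 (ext_zero (@unit_idem i)).
Proof.
apply/Zell1P; split; first exact: ell1_ext_zero.
exact/class_ext_zero/unit_idem_class.
Qed.

Lemma Zell1_prod_idem F : Zell1 (prod_idem F).
Proof.
elim/fset1U_rect: F => [|i F iF IH]; first by rewrite prod_idem0; apply: Zell1_delta.
by rewrite prod_idemU1 //; apply: Zell1_convol => //; apply: Zell1_unit_idem.
Qed.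

Lemma ell1_prod_idem F : ell1 (prod_idem F).
Proof. exact: Zell1_ell1 (Zell1_prod_idem F). Qed.

Lemma prod_idemA F f g : ell1 f -> ell1 g ->
  convol (convol (prod_idem F) f) g = convol (prod_idem F) (convol f g).
Proof.
move=> fl gl; elim/fset1U_rect: F => [|i F iF IH].
  by rewrite prod_idem0 !convol_delta.
have Fl := ell1_prod_idem F.
by rewrite prod_idemU1 // !convol_ext_zeroA ?IH //; apply: ell1_convol.
Qed.

Lemma prod_idemU F E : [disjoint F & E]%fset ->
  prod_idem (F `|` E)%fset = convol (prod_idem F) (prod_idem E).
Proof.
elim/fset1U_rect: F => [|i F iF IH]; first by rewrite fset0U prod_idem0 convol_delta.
rewrite fdisjointU1X => /andP[iE FE].
rewrite -fsetUA prod_idemU1 ?inE ?negb_or ?iF // IH // prod_idemU1 //.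
by rewrite convol_ext_zeroA //; apply: ell1_prod_idem.
Qed.

(** One inequality is submultiplicativity. For the other, the points [inc i a * x] with [x i = 1]
    are pairwise distinct, and the product idempotent factors at them. *)
Lemma norm1_prod_idem F : norm1 (prod_idem F) = \prod_(i <- F) idem_norm i.
Proof.
elim/fset1U_rect: F => [|i F iF IH].
  rewrite prod_idem0 big_seq_fset0; apply/le_anti; rewrite norm1_delta /=.
  have := norm1_term 1%g (@ell1_delta R (restr_prod G)).
  by rewrite /delta1 eqxx ComplexField.Normc.normc1.
rewrite big_fsetU1 //= -IH; apply/le_anti/andP; split.
  rewrite prod_idemU1 //; apply: le_trans (norm1_convol _ (ell1_prod_idem F)) _.
    exact: ell1_ext_zero.
  by rewrite ler_wpM2r ?norm1_ge0 // norm1_ext_zero.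
have n0 : 0 < idem_norm i := lt_le_trans ltr01 (idem_norm_ge1 i).
rewrite mulrC -ler_pdivlMr //; apply: norm1_le => A; rewrite ler_pdivlMr //.
rewrite (big_fsetID _ (fun x => x i == 1%g)) /= [X in _ + X]big1_fset ?addr0; last first.
  move=> x; rewrite !inE => /andP[_ xi] _; rewrite /prod_idem.
  case: supportedP => [/(_ i iF) E|_]; first by rewrite E eqxx in xi.
  exact: ComplexField.Normc.normc0.
set B := [fset x | x in A & x i == 1%g]%fset.
have B1 x : x \in B -> x i = 1%g by rewrite !inE => /andP[_ /eqP].
rewrite mulr_suml.
apply: le_trans (_ : \sum_(x <- B) \sum_(a : G i)
    nrm (prod_idem (i |` F)%fset (inc i a * x)%g) <= _).
  rewrite big_seq [leRHS]big_seq; apply: ler_sum => x /B1 x1.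
  rewrite mulr_sumr; apply: ler_sum => a _.
  rewrite -ComplexField.Normc.normcM mulrC prod_idemU1 // convol_ext_zero.
  rewrite (bigD1 a) //= mulKg big1 ?addr0 // => b ba; rewrite /prod_idem.
  case: supportedP => [/(_ i iF)|_]; last by rewrite mulr0.
  rewrite !rp_mulE rp_invE !coord_incl_in x1 mulg1 => /eqP.
  by rewrite mulg_eq1 eqg_inv (negPf ba).
rewrite exchange_big /= -big_enum /=.
have := norm1_bounded (ell1_prod_idem (i |` F)%fset)
  [fset (inc i a * x)%g | a in G i, x in B]%fset.
rewrite big_imfset2 //= => -[a x] [b y]; rewrite !inE /= => xB yB E.
have ab : a = b.
  have := congr1 (fun z : restr_prod G => z i) E.
  by rewrite !rp_mulE !coord_incl_in !B1 ?inE // !mulg1.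
by move: E; rewrite ab => /mulgI ->.
Qed.

(** With the other coordinates frozen, this is a convolution on [G i] of [psi], up to the mass, with
    [g0]. Since [inc i b] commutes with [strip i x], [g0] is a class function and [spherical_convol]
    applies. *)
Lemma prod_idem_convol_eigen F f x i : Zell1 f -> i \in F ->
  convol (prod_idem F) f x = psi (x i) * convol (prod_idem F) f (strip i x).
Proof.
move=> fZ iF; have fl := Zell1_ell1 fZ.
rewrite -(fsetD1K iF) prod_idemU1 ?inE ?eqxx //.
have Fl := ell1_prod_idem (F `\ i)%fset.
rewrite convol_ext_zeroA //.
set g := convol (prod_idem _) f.
have gJ : class_function g.
  exact: Zell1_class (Zell1_convol (Zell1_prod_idem _) fZ).
pose g0 (a : G i) := g (inc i a * strip i x)%g.
have g0J a b : g0 (a ^ b)%g = g0 a.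
  rewrite /g0 -[RHS](gJ _ (inc i b)) conjMg.
  have -> : (strip i x ^ inc i b = strip i x)%g.
    by rewrite conjgE -coord_incl_commute ?strip_in // mulKg.
  have -> : (inc i a ^ inc i b = inc i (a ^ b))%g.
    apply: rp_ext => j; have [->|ji] := eqVneq (j : T) i.
      by rewrite conjgE !rp_mulE rp_invE !coord_incl_in.
    by rewrite conjgE !rp_mulE rp_invE !coord_incl_out // invg1 !mulg1.
  by [].
have inclM (a b : G i) : (inc i a * inc i b = inc i (a * b))%g.
  apply: rp_ext => j; rewrite rp_mulE; have [->|ji] := eqVneq (j : T) i.
    by rewrite !coord_incl_in.
  by rewrite !coord_incl_out // mulg1.
have conv0 b : \sum_(a : G i) unit_idem a * g ((inc i a)^-1 * (inc i b * strip i x))%g =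
    (\sum_(a : G i) psi (b * a^-1)%g * g0 a) / (mass i)%:C%C.
  rewrite mulr_suml (reindex_inj (mulgI b)) (reindex_inj invg_inj) /=.
  apply: eq_bigr => a _; rewrite /unit_idem mulrAC; congr (_ * _ * _).
  by rewrite mulgA -coord_inclV inclM invgM invgK mulgVK.
have inc1 : inc i 1%g = 1%g.
  apply: rp_ext => j; have [->|ji] := eqVneq (j : T) i; first exact: coord_incl_in.
  exact: coord_incl_out.
rewrite !convol_ext_zero -{1}(stripK i x) conv0.
rewrite -[in RHS](mul1g (strip i x)) -inc1 conv0.
rewrite !(spherical_convol (psiS i)) // (psiS i).1 mul1r.
by rewrite mulrA.
Qed.

Lemma prod_idem_convol_supp F f x : Zell1 f -> (forall y, ~~ supported F y -> f y = 0) ->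
  ~~ supported F x -> convol (prod_idem F) f x = 0.
Proof.
move=> fZ f0 xF; apply: convol_eq.
have := @has_sum_fset _ _ (fun y => prod_idem F y * f (y^-1 * x)%g) fset0.
rewrite big_seq_fset0; apply=> y _; rewrite /prod_idem; case: ifP => yF; last by rewrite mul0r.
rewrite f0 ?mulr0 //; apply: contra xF => yxF.
by rewrite -(mulVKg y x); apply: supportedM.
Qed.

(* On elements supported in [F], both [prod_idem F] and its product with [f]
   are eigenfunctions of every [strip], with eigenvalue [psi]. *)
Lemma prod_idem_convol F f : Zell1 f -> (forall y, ~~ supported F y -> f y = 0) ->
  exists c, convol (prod_idem F) f = c \*o prod_idem F.
Proof.
move=> fZ f0; pose u := convol (prod_idem F) f.
pose q := \prod_(i <- F) unit_idem (1%g : G i).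
have q0 : q != 0.
  rewrite /q prodf_seq_neq0; apply/allP => i _; exact: unit_idem1_neq0.
exists (u 1%g / q); apply/funext => x /=; have [xF|xF] := boolP (supported F x); last first.
  by rewrite /prod_idem (negPf xF) mulr0; apply: prod_idem_convol_supp.
suff main E : (E `<=` F)%fset -> supported E x ->
    u x * q = u 1%g * \prod_(i <- F) unit_idem (x i).
  apply: (mulIf q0); rewrite -/u (main F) ?fsubset_refl // /prod_idem xF.
  by rewrite mulrAC mulfVK.
elim/fset1U_rect: E x {xF} => [|i E iE IH] x.
  by rewrite supported0 => _ /eqP ->.
rewrite fsubUset fsub1set => /andP[iF EF]; rewrite supportedU1 => /IH -/(_ EF) main.
rewrite /u (prod_idem_convol_eigen x fZ iF) -mulrA -/u main mulrCA.
congr (_ * _); rewrite (big_fsetD1 i iF) [RHS](big_fsetD1 i iF) strip_in mulrA.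
rewrite -(unit_idem_psi (x i)); congr (_ * _).
rewrite big_seq [RHS]big_seq; apply: eq_bigr => j; rewrite in_fsetD1 => /andP[ji _].
by rewrite strip_out.
Qed.

End ProductIdempotents.

(** * Bounded approximate identities of the kernel *)

Section Kernel.
Variables (R : realType) (I : Type) (G : I -> finGroupType).
Local Notation T := {classic I}.
Local Notation C := R[i].
Variable w : (restr_prod G -> C) -> C.
Hypothesis wchar : algebra_character w.
Variable psi : forall i : I, G i -> C.
Hypothesis psiS : forall i, spherical (@psi i).
Local Notation p := (@prod_idem R I G psi).
Local Notation n := (@idem_norm R I G psi).
Hypothesis w_idem : forall i, w (ext_zero (unit_idem psi (i := i))) = 1.
Implicit Types (F E : {fset T}) (f g h : restr_prod G -> C).

Lemma character_prod_idem F : w (p F) = 1.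
Proof.
have [_ wmul _] := wchar.
elim/fset1U_rect: F => [|i F iF IH]; first by rewrite prod_idem0 character_delta.
by rewrite prod_idemU1 // wmul ?IH ?w_idem ?mul1r //;
  [exact: Zell1_unit_idem | exact: Zell1_prod_idem].
Qed.

Lemma prod_idem_convol_char F f : Zell1 f ->
  (forall y, ~~ supported F y -> f y = 0) -> convol (p F) f = w f \*o p F.
Proof.
move=> fZ f0; have [c cE] := prod_idem_convol psiS fZ f0.
have pZ := Zell1_prod_idem psiS F; have [_ wmul _] := wchar.
have : w (convol (p F) f) = c by rewrite cE characterZ // character_prod_idem mulr1.
by rewrite wmul // character_prod_idem mul1r cE => <-.
Qed.

(** On the restricted part, convolution by [p F] is multiplication by its character value, which is
    [- w (f \- restrict F f)] since [w f = 0]. Both this term and the rest cost at most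
    [norm1 (f \- restrict F f) * norm1 (p F)]. *)
Lemma norm1_prod_idem_ker F f : character_ker w f ->
  norm1 (convol (p F) f) <= 2 * norm1 (f \- restrict F f) * norm1 (p F).
Proof.
move=> [fZ wf]; have pZ := Zell1_prod_idem psiS F.
have rZ := Zell1_restrict F fZ; have dZ := Zell1B fZ rZ.
have [[[pl fl] rl] dl] := (Zell1_ell1 pZ, Zell1_ell1 fZ, Zell1_ell1 rZ, Zell1_ell1 dZ).
have -> : convol (p F) f =
    convol (p F) (f \- restrict F f) \- w (f \- restrict F f) \*o p F.
  have r0 y : ~~ supported F y -> restrict F f y = 0.
    by rewrite /restrict => /negPf ->.
  rewrite convolBr // characterB // wf sub0r (prod_idem_convol_char rZ r0).
  by apply/funext => x /=; rewrite mulNr opprK subrK.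
apply: le_trans (norm1B _ _) _; [exact: ell1_convol | exact: ell1Z |].
rewrite mulrDl mul1r mulrDl; apply: lerD.
  by rewrite [leRHS]mulrC; apply: norm1_convol.
apply: le_trans (norm1Z _ pl) _.
by rewrite ler_wpM2r ?norm1_ge0 // character_bound.
Qed.

Lemma ker_delta_prod_idem F : character_ker w (@delta1 R (restr_prod G) \- p F).
Proof.
have pZ := Zell1_prod_idem psiS F; have dZ := Zell1_delta R (restr_prod G).
split; first exact: Zell1B.
by rewrite characterB // character_delta // character_prod_idem subrr.
Qed.

(** The net is [1 - p F] over finite sets [F] ordered by inclusion. Its error at [f] is
    [- convol (p F) f], which is small once [F] carries most of [f]. *)
Lemma prod_idem_norm_bounded (K : R) : (forall F, norm1 (p F) <= K) ->
  has_bounded_approx_id (character_ker w).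
Proof.
move=> pK; pose d := @delta1 R (restr_prod G).
have dl : ell1 d := @ell1_delta R (restr_prod G).
exists {fset T}, (fun F E => F `<=` E)%fset, (fun F => d \- p F); split.
- split=> [|F|F E D|F E]; first exact: inhabits fset0.
  + exact: fsubset_refl.
  + exact: fsubset_trans.
  + by exists (F `|` E)%fset; [exact: fsubsetUl | exact: fsubsetUr].
- exact: ker_delta_prod_idem.
- exists (1 + K) => F; apply: le_trans (norm1B dl (ell1_prod_idem psiS F)) _.
  by apply: lerD => //; exact: norm1_delta.
move=> f fker; have [fZ _] := fker; have fl := Zell1_ell1 fZ.
have K0 : 0 <= K := le_trans (norm1_ge0 _) (pK fset0).
have bound F : norm1 (convol (d \- p F) f \- f) <=
    2 * norm1 (f \- restrict F f) * K.
  have pl := ell1_prod_idem psiS F.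
  rewrite (_ : _ \- f = \- convol (p F) f).
    rewrite norm1N; apply: le_trans (norm1_prod_idem_ker F fker) _.
    by rewrite ler_wpM2l // mulr_ge0 ?norm1_ge0.
  apply/funext => x; rewrite convolBl // /d convol_delta /=.
  by rewrite addrAC subrr sub0r.
move=> A /nbhs_ballP[e /= e0 eA].
(* [K + 1] keeps the divisor positive, and halving [e] makes the final inequality strict. *)
have K1 : 0 < 2 * (K + 1) by rewrite mulr_gt0 // ltr_wpDl.
have [F FP] := restrict_approx fl (divr_gt0 (divr_gt0 e0 (ltr0n _ 2)) K1).
exists F => // E /= /FP fE; apply: eA; rewrite /ball /= sub0r normrN.
rewrite ger0_norm ?norm1_ge0 //; apply: le_lt_trans (bound E) _.
have := norm1_ge0 (f \- restrict E f).
move: fE; rewrite ler_pdivlMr //; move: (norm1 _) => t fE t0; nra.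
Qed.

(** An element [h a] nearly fixes [1 - p F]. Multiplying by [q = p F'], with [F'] disjoint from [F]
    and large enough for [E] to carry most of [h a], bounds [norm1 (p E)] by a multiple of [norm1 q]
    plus half of [norm1 (p E)] itself; [norm1 q] then cancels. *)
Lemma bounded_approx_id_prod_idem : has_bounded_approx_id (character_ker w) ->
  exists K : R, forall F, norm1 (p F) <= K.
Proof.
move=> [A [le [h [[_ le_refl _ _] hJ [M hM] happ]]]]; exists (2 * (M + 2)) => F.
pose d := @delta1 R (restr_prod G).
have dl : ell1 d := @ell1_delta R (restr_prod G).
have [a ha] : exists a, norm1 (convol (h a) (d \- p F) \- (d \- p F)) <= 1 / 4.
  have /= := happ _ (ker_delta_prod_idem F).
  move=> /(_ (ball (0 : R) (1 / 4)))[|a _ /(_ a (le_refl a))].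
    by apply: nbhsx_ballx; rewrite divr_gt0.
  by rewrite /ball /= sub0r normrN ger0_norm ?norm1_ge0 // => /ltW; exists a.
have [hZ wh] := hJ a; have hl := Zell1_ell1 hZ.
have quarter : 0 < 1 / 4 :> R by rewrite divr_gt0.
have [F0 F0P] := restrict_approx hl quarter.
pose E := (F `|` F0)%fset; pose F' := (E `\` F)%fset.
have EF : (F `|` F')%fset = E by rewrite fsetUDl fsetDv fsetD0 fsetUA fsetUid.
have disj : [disjoint F & F']%fset by apply/fdisjointP => i iF; rewrite !inE iF.
have pl D := ell1_prod_idem psiS D.
have pZ D := Zell1_prod_idem psiS D.
set q := p F'; have ql : ell1 q := pl F'.
have qd : convol q d = q by rewrite [LHS](pZ F').2 // /d convol_delta.
have qpF : convol q (p F) = p E.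
  by rewrite -prod_idemU 1?fdisjoint_sym // fsetUC EF.
have pE : norm1 (p E) = norm1 (p F) * norm1 q.
  rewrite /q !norm1_prod_idem // [LHS](big_fsetID _ (mem F)) /=.
  congr (_ * _); apply: eq_fbigl => i; rewrite !inE.
    by case: (i \in F); rewrite ?andbF.
  by rewrite andbC.
have q1 : 1 <= norm1 q by rewrite norm1_prod_idem // prod_idem_norm_ge1.
pose v := convol (h a) (d \- p F) \- (d \- p F).
have dpl : ell1 (d \- p F) by apply: ell1B.
have vl : ell1 v by apply: ell1B => //; apply: ell1_convol.
(* This is [q] times the definition of [v], with [q] times [p F] equal to [p E], solved for
   [p E]. *)
have pEE : p E = (q \+ convol q v) \- (convol q (h a) \- convol (p E) (h a)).
  have -> : convol q v = (convol q (h a) \- convol (p E) (h a)) \- (q \- p E).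
    have -> : v = (h a \- convol (p F) (h a)) \- (d \- p F).
      rewrite /v hZ.2 // convolBl //.
      by rewrite /d convol_delta.
    have phl : ell1 (convol (p F) (h a)) by exact: ell1_convol.
    rewrite !convolBr //; last exact: ell1B.
    rewrite qpF -prod_idemA // ?qpF //.
    by rewrite qd.
  by apply/funext => x /=; ring.
have qh : norm1 (convol q (h a)) <= norm1 q * M.
  apply: le_trans (norm1_convol (pl _) hl) _.
  by rewrite ler_wpM2l ?norm1_ge0.
have qv : norm1 (convol q v) <= norm1 q * (1 / 4).
  apply: le_trans (norm1_convol (pl _) vl) _.
  by rewrite ler_wpM2l ?norm1_ge0.
have ph : norm1 (convol (p E) (h a)) <= (1 / 2) * norm1 (p E).
  apply: le_trans (norm1_prod_idem_ker E (hJ a)) _.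
  rewrite ler_wpM2r ?norm1_ge0 //.
  have := F0P E (fsubsetUr _ _); lra.
have qvl : ell1 (convol q v) by exact: ell1_convol.
have qhl : ell1 (convol q (h a)) by exact: ell1_convol.
have phl : ell1 (convol (p E) (h a)) by exact: ell1_convol.
have : norm1 (p E) <= norm1 q + norm1 (convol q v) +
    (norm1 (convol q (h a)) + norm1 (convol (p E) (h a))).
  rewrite {1}pEE; apply: le_trans (norm1B _ _) _; [|exact: ell1B|].
    exact: ell1D.
  by apply: lerD; [exact: norm1D | exact: norm1B].
rewrite pE in ph * => main; have q0 : 0 < norm1 q := lt_le_trans ltr01 q1.
(* Absorbing the half leaves [norm1 (p F) / 2 <= 1 + 1/4 + M], within the announced
   [2 * (M + 2)]. *)
rewrite -(ler_pM2r q0); lra.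
Qed.

End Kernel.

Lemma bernoulli_le (R : realDomainType) (t : R) k : 0 <= t -> 1 + t *+ k <= (1 + t) ^+ k.
Proof.
move=> t0; elim: k => [|k IH]; first by rewrite mulr0n addr0 expr0.
rewrite exprS mulrDl mul1r mulrSr addrA lerD //.
apply: ler_peMr => //; apply: le_trans IH; by rewrite lerDl mulrn_wge0.
Qed.

(** * From characters to idempotents, and the equivalence *)

Section NormalizedCharacter.
Variables (R : realType) (I : Type) (G : I -> finGroupType).
Variable chi : forall i : I, G i -> R[i].
Hypothesis chi_irr : forall i, irr_group_character (@chi i).

Definition normalized_char i (x : G i) : R[i] := chi x / chi (1%g : G i).
Local Notation psi := normalized_char.

Lemma normalized_char_spherical i : spherical (@psi i).
Proof. exact: irr_character_spherical. Qed.

(** Orthonormality makes the mass [|G i| / d^2], so the norm is [d] times the sum of [|chi x|],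
    divided by [|G i|]. The left equality is real, the right one complex. *)
Lemma idem_norm_char i : idem_norm psi i = 1 <->
  chi (1%g : G i) * \sum_(x : G i) `|chi x| = #|G i|%:R.
Proof.
have [d d0 chi1] := irr_character_degree (chi_irr i).
have dR : 0 < d%:R :> R by rewrite ltr0n.
have dN : d%:R != 0 :> R by rewrite gt_eqF.
have GR : #|G i|%:R != 0 :> R.
  by rewrite pnatr_eq0 -lt0n; apply/card_gt0P; exists 1%g.
have nd : nrm (d%:R : R[i]) = d%:R.
  by rewrite -(rmorph_nat (real_complex R)) normc_real ?ler0n.
have npsi x : nrm (@psi i x) = nrm (chi x) / d%:R.
  by rewrite /psi chi1 ComplexField.Normc.normcM ComplexField.Normc.normcV nd.
have massE : mass psi i = #|G i|%:R / d%:R ^+ 2.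
  rewrite -(irr_character_norm2 (chi_irr i)) /mass mulr_suml.
  by apply: eq_bigr => x _; rewrite npsi expr_div_n.
have -> : idem_norm psi i = d%:R * (\sum_(x : G i) nrm (chi x)) / #|G i|%:R.
  rewrite (idem_normE normalized_char_spherical) massE.
  under eq_bigr do rewrite npsi.
  by rewrite -mulr_suml; field; rewrite dN GR.
rewrite chi1 -(rmorph_nat (real_complex R) d) -(rmorph_nat (real_complex R) #|G i|).
rewrite -(rmorph_sum (real_complex R)) -rmorphM; split=> [E|/complexI ->].
  by congr (_%:C)%C; rewrite -[LHS](mulfVK GR) E mul1r.
by rewrite divff.
Qed.

(** The formula for [w] on the factor gives the sum of [psi x * psi x^-1] divided by the mass, and
    [psi x^-1] is the conjugate of [psi x]. *)
Lemma corresponding_unit_idem (w : (restr_prod G -> R[i]) -> R[i]) i :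
  corresponding_family w chi -> w (ext_zero (unit_idem psi (i := i))) = 1.
Proof.
move=> /(_ i)[_ wE]; have psiS := normalized_char_spherical.
rewrite wE; last first.
  apply/Zell1P; split; last exact: unit_idem_class.
  by apply: (@ell1_fset _ _ _ [fset x in G i]%fset) => x; rewrite !inE.
have E : \sum_(x : G i) psi x * psi x^-1%g = (mass psi i)%:C%C.
  rewrite /mass rmorph_sum; apply: eq_bigr => x _.
  by rewrite (spherical_inv _ (psiS i)) mulcJ.
rewrite -[RHS](divff (mass_neq0 psiS i)) -{1}E mulr_suml; apply: eq_bigr => x _.
rewrite /unit_idem /psi; set m := (_%:C)%C; ring.
Qed.

End NormalizedCharacter.

Theorem theorem4p2 (R : realType) (I : Type) (G : I -> finGroupType)
    (w : (restr_prod G -> R[i]) -> R[i]) (chi : forall i : I, G i -> R[i]) :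
  algebra_character w ->
  corresponding_family w chi ->
  has_bounded_approx_id (character_ker w) <->
  finite_set [set i : I |
    ~ (chi i 1%g * \sum_(x : G i) `|chi i x| = #|G i|%:R)].
Proof.
move=> wchar wchi; have chi_irr i : irr_group_character (chi i) := (wchi i).1.
have psiS := normalized_char_spherical chi_irr.
have w_idem i := corresponding_unit_idem chi_irr i wchi.
set n := idem_norm (normalized_char chi).
pose bad := [set i : {classic I} | n i != 1].
have -> : [set i : I | ~ (chi i 1%g * \sum_(x : G i) `|chi i x| = #|G i|%:R)] = bad.
  by apply/seteqP; split=> i /=; rewrite -idem_norm_char // => /eqP.
have norm_ge1 i : 1 <= n i by exact: idem_norm_ge1.
split=> [/(bounded_approx_id_prod_idem wchar psiS w_idem)[K KP]|fin_bad].
  apply: contrapT => inf_bad.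
  have K1 : 0 <= K := le_trans (norm1_ge0 _) (KP fset0).
  (* By the gap and Bernoulli's inequality, [k] bad indices give a product of norms of at least
     [1 + k / 1000]. *)
  have [k kK] : exists k : nat, K < 1 + (1 / 1000) *+ k.
    exists (Num.bound (1000 * K)).
    have := archi_boundP (mulr_ge0 (ler0n R 1000) K1).
    rewrite -[_ *+ Num.bound _]mulr_natl; lra.
  have [F Fbad kF] := @infinite_set_fset {classic I} bad k inf_bad.
  have t0 : 0 <= 1 / 1000 :> R by lra.
  have := KP F; apply/negP; rewrite -ltNge; apply: lt_le_trans kK _.
  apply: le_trans (bernoulli_le k t0) _; rewrite norm1_prod_idem //.
  apply: le_trans (_ : (1 + 1 / 1000) ^+ #|` F| <= _).
    by apply: ler_weXn2l => //; rewrite lerDl.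
  rewrite -(count_predT F) -iter_mulr_1 -big_const_seq big_seq [leRHS]big_seq.
  apply: ler_prod => i /Fbad n1; rewrite addr_ge0 //=.
  exact: idem_norm_gap psiS _ n1.
(* Factors outside [B] equal 1 and those in [B] are at least 1, so the product over [B] dominates
   all others. *)
pose B := fset_set bad.
apply: (prod_idem_norm_bounded wchar psiS w_idem (K := \prod_(i <- B) n i)) => F.
rewrite norm1_prod_idem // (big_fsetID _ (mem B)) /=.
rewrite [X in _ * X]big1_fset ?mulr1 => [|i]; last first.
  rewrite !inE => /andP[_ iB] _; apply/eqP; apply: contraNT iB => n1.
  by rewrite /B in_fset_set //; apply: mem_set.
rewrite [leRHS](big_fsetID _ (mem F)) /=.
rewrite (_ : [fset i | i in F & i \in B]%fset = [fset i | i in B & i \in F]%fset).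
  apply: ler_peMr; last exact: prod_idem_norm_ge1.
  exact: le_trans ler01 (prod_idem_norm_ge1 psiS _ _).
by apply/fsetP => i; rewrite !inE andbC.
Qed.
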